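(* Let $\phi:G\times Q\to Q$ be a free action of a Lie group $G$ such that $\eta=\Pi^*(dt)$ is $G$-invariant, let $h:V^*\Pi\to T^*Q$ be a $G$-equivariant Hamiltonian section of $\mu$, and assume that $\ker\omega_h(\alpha_q)\cap T_{\alpha_q}(G\cdot\alpha_q)=\{0\}$ for all $\alpha_q\in T^*Q$. Let $\nu\in\mathfrak g^*$ with $J^{-1}(\nu)\neq\emptyset$, and suppose that $(T^*Q)_\nu=J^{-1}(\nu)/G_\nu$ and $(V^*\Pi)_\nu=(J^V)^{-1}(\nu)/G_\nu$ are manifolds such that the canonical projections $\pi_\nu:J^{-1}(\nu)\to(T^*Q)_\nu$ and $\pi_\nu^V:(J^V)^{-1}(\nu)\to(V^*\Pi)_\nu$ are submersions. Let $\mu_\nu:(T^*Q)_\nu\to(V^*\Pi)_\nu$ be the reduced principal $\mathbb R$-bundle with principal action $\psi_\nu$, and let $\omega_h^\nu$ and $\Omega_h^\nu$ be the reduced presymplectic structures on $(T^*Q)_\nu$ and $(V^*\Pi)_\nu$. Then: (i) $\mu_\nu^*\Omega_h^\nu=\omega_h^\nu$. (ii) The vector field $X_\nu$ on $(T^*Q)_\nu$ is $\mu_\nu$-projectable over the vector field $R_h^\nu$ on $(V^*\Pi)_\nu$, i.e. $$T_{\pi_\nu(\alpha_q)}\mu_\nu\big(X_\nu(\pi_\nu(\alpha_q))\big)=R_h^\nu\big(\mu_\nu(\pi_\nu(\alpha_q))\big),\qquad \alpha_q\in J^{-1}(\nu).$$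
   Context: Setting: $Q$ is a connected smooth manifold of dimension $n+1$, $\Pi:Q\to\mathbb R$ is a fibration (surjective submersion), $\eta=\Pi^*(dt)\in\Omega^1(Q)$, and $V\Pi=\{u\in TQ\mid \eta(u)=0\}$ is the vertical bundle, with dual bundle $\tau:V^*\Pi\to Q$. $\pi_Q:T^*Q\to Q$ is the projection. $\mu:T^*Q\to V^*\Pi$ is the dual of the inclusion $V\Pi\hookrightarrow TQ$; it is a principal $\mathbb R$-bundle with action $\psi(s,\alpha_q)=\alpha_q+s\,\eta(q)$. $\omega_Q=-d\lambda_Q$ is the canonical symplectic form ($\lambda_Q$ the Liouville 1-form), $i_X\omega=\omega(X,\cdot)$, and $\eta_0=(\Pi\circ\pi_Q)^*(dt)$. A Hamiltonian section is a smooth section $h:V^*\Pi\to T^*Q$ of $\mu$. Its extended Hamiltonian function $F_h:T^*Q\to\mathbb R$ is determined by $\alpha_q-h(\mu(\alpha_q))=F_h(\alpha_q)\eta(q)$. Put $\Omega_h=h^*\omega_Q$ and $\omega_h=\omega_Q+dF_h\wedge\eta_0$. $X_{F_h}^{\omega_Q}$ is the vector field on $T^*Q$ with $i_{X_{F_h}^{\omega_Q}}\omega_Q=dF_h$; $R_h\in\mathfrak X(V^*\Pi)$ is the vector field determined by $i_{R_h}\Omega_h=0$ and $(\tau^*\eta)(R_h)=1$. Group actions: $\mathfrak g$ is the Lie algebra of $G$. $T^*\phi$ is the cotangent lift, $(T_g^*\phi(\alpha_q))(u)=\alpha_q(T_{\phi_g(q)}\phi_{g^{-1}}(u))$ for $u\in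 T_{\phi_g(q)}Q$, and $G\cdot\alpha_q$ is its orbit; when $\eta$ is $G$-invariant ($\phi_g^*\eta=\eta$ for all $g$), $V^*\phi$ is the action on $V^*\Pi$ given by the same formula for $u\in V_{\phi_g(q)}\Pi$. $h$ is $G$-equivariant if $T_g^*\phi\circ h=h\circ V_g^*\phi$ for all $g$. $G$-invariance of $\eta$ gives a smooth $m:G\to\mathbb R$ with $m(gh)=m(g)+m(h)$ and $\Pi\circ\phi_g=\Pi+m(g)$; put $c_\phi=dm(e)\in\mathfrak g^*$. The momentum map $J:T^*Q\to\mathfrak g^*$ is $J(\alpha_q)(\xi)=\alpha_q(\xi_Q(q))-F_h(\alpha_q)c_\phi(\xi)$, with $\xi_Q$ the infinitesimal generator of $\xi$ on $Q$, and $J^V:V^*\Pi\to\mathfrak g^*$ is characterized by $J=J^V\circ\mu$. Both are $Ad^*$-equivariant, and when $\phi$ is free, $\eta$ is $G$-invariant, $h$ is $G$-equivariant and $\ker\omega_h(\alpha_q)\cap T_{\alpha_q}(G\cdot\alpha_q)=\{0\}$ for all $\alpha_q\in T^*Q$, their level sets are submanifolds, with inclusions $\iota_\nu:J^{-1}(\nu)\hookrightarrow T^*Q$, $\iota_\nu^V:(J^V)^{-1}(\nu)\hookrightarrow V^*\Pi$. $G_\nu$ is the coadjoint isotropy subgroup of $\nu$; it acts on $J^{-1}(\nu)$ via $T^*\phi$ and on $(J^V)^{-1}(\nu)$ via $V^*\phi$. Reduced objects: $\omega_h^\nu$ and $\Omega_h^\nu$ are the 2-forms with $\pi_\nu^*\omega_h^\nu=\iota_\nu^*\omega_h$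 and $(\pi_\nu^V)^*\Omega_h^\nu=(\iota_\nu^V)^*\Omega_h$. $X_{F_h}^{\omega_Q}$ is tangent to $J^{-1}(\nu)$ and its restriction is $\pi_\nu$-projectable onto $X_\nu\in\mathfrak X((T^*Q)_\nu)$; $R_h$ is tangent to $(J^V)^{-1}(\nu)$ and its restriction is $\pi_\nu^V$-projectable onto $R_h^\nu\in\mathfrak X((V^*\Pi)_\nu)$, which spans $\ker\Omega_h^\nu$. $\mu_\nu$ is characterized by $\mu_\nu\circ\pi_\nu=\pi_\nu^V\circ\mu|_{J^{-1}(\nu)}$, and $\psi_\nu$ by $(\psi_\nu)_s\circ\pi_\nu=\pi_\nu\circ\psi_s|_{J^{-1}(\nu)}$. *)

(* Defs.v *)
From HB Require Import structures.
From mathcomp Require Import all_boot all_order all_algebra.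
From mathcomp Require Import all_classical all_reals all_analysis.
From mathcomp Require Import ring.

Set Implicit Arguments.
Unset Strict Implicit.
Unset Printing Implicit Defensive.

Import Order.TTheory GRing.Theory Num.Theory numFieldNormedType.Exports.
Local Open Scope classical_set_scope.
Local Open Scope ring_scope.

(* A smooth manifold is presented by its algebra of smooth real functions: it
   is a differential space in the sense of Sikorski that is locally
   diffeomorphic to R^n, Hausdorff and second countable.  For such spaces this
   is the same thing as a maximal C^oo atlas.  Products, subspaces and the total
   spaces of (co)vector bundles are given by generating functions.

   The tangent map, covectors given by a formula, etc. are total functions;
   they take the value 0 when the data are not smooth (resp. not linear), as
   `derive` and `lim` do in the library. *)

Section SmoothFunctions.
Variable R : realType.

Fixpoint Cdiff k (j : nat) (W : set 'rV[R]_k) (u : 'rV[R]_k -> R) : Prop :=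
  (forall x, W x -> {for x, continuous u}) /\
  if j is j'.+1 then
    forall i : 'I_k, (forall x, W x -> derivable u x (delta_mx 0 i)) /\
      Cdiff j' W (fun x => 'D_(delta_mx 0 i) u x)
  else True.

(* Only used for W open. *)
Definition Cinf k (W : set 'rV[R]_k) (u : 'rV[R]_k -> R) : Prop :=
  forall j, Cdiff j W u.

Section DifferentialStructure.
Variables (T : Type) (C : set (T -> R)).

(* Open sets of the initial topology of the family C. *)
Definition iopen (U : set T) : Prop :=
  forall p, U p -> exists m (f : 'I_m -> T -> R) (e : R),
    [/\ forall i, C (f i), 0 < e
      & forall x, (forall i, `|f i x - f i p| < e) -> U x].

Definition locally_in (U : set T) (f : T -> R) : Prop :=
  forall p, U p -> exists (g : T -> R) (V : set T),
    [/\ C g, iopen V, V p & forall x, V x -> f x = g x].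

Definition is_dstruct : Prop :=
  (forall f, locally_in setT f -> C f) /\
  (forall m (f : 'I_m -> T -> R) (u : 'rV[R]_m -> R),
     (forall i, C (f i)) -> Cinf setT u -> C (fun x => u (\row_i f i x))).

End DifferentialStructure.

Record dspace := DSpace {
  dcarrier :> Type;
  sm : set (dcarrier -> R);
  smP : is_dstruct sm }.

Definition gen_smooth T (G : set (T -> R)) : set (T -> R) :=
  [set f | forall C, is_dstruct C -> G `<=` C -> C f].

Lemma gen_dstruct T (G : set (T -> R)) : is_dstruct (gen_smooth G).
Proof.
split=> [f locf C dC GC|m f u Gf Cu C dC GC]; last first.
  by apply: dC.2 => // i; exact: Gf.
apply: dC.1 => p _; have [g [V [Gg oV Vp fg]]] := locf p I.
exists g, V; split=> //; first exact: Gg.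
move=> q Vq; have [m [a [e [Ga e0 aV]]]] := oV q Vq.
by exists m, a, e; split=> // i; exact: Ga.
Qed.

Definition gen_space T (G : set (T -> R)) : dspace := DSpace (gen_dstruct G).

Definition dopen (M : dspace) : set M -> Prop := iopen (@sm M).

Definition smooth (M N : dspace) (f : M -> N) : Prop :=
  forall g, sm (d := N) g -> sm (d := M) (g \o f).

Definition diffeo (M N : dspace) (f : M -> N) : Prop :=
  smooth f /\ exists g : N -> M, [/\ cancel f g, cancel g f & smooth g].

Definition Rline : dspace := gen_space [set (id : R -> R)].

Definition prod_space (M N : dspace) : dspace :=
  @gen_space (M * N)%type
    [set F | (exists2 f : M -> R, sm f & F = f \o fst) \/
             (exists2 f : N -> R, sm f & F = f \o snd)].

Definition sub_space (M : dspace) (A : set M) : dspace :=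
  @gen_space (set_type A)
    [set F | exists2 f : M -> R, sm f & F = fun x => f (val x)].

(* x restricts to a diffeomorphism from U onto an open subset of R^n. *)
Definition chart (M : dspace) n (U : set M) (x : M -> 'rV[R]_n) : Prop :=
  [/\ dopen U, {in U &, injective x}, open (x @` U)
    & forall u : 'rV[R]_n -> R,
        Cinf (x @` U) u <-> locally_in (@sm M) U (u \o x)].

Definition is_manifold n (M : dspace) : Prop :=
  [/\ forall p : M, exists (U : set M) (x : M -> 'rV[R]_n), U p /\ chart U x,
      forall p q : M, p <> q -> exists U V : set M,
        [/\ dopen U, dopen V, U p, V q & U `&` V = set0]
    & exists2 B : nat -> set M, forall i, dopen (B i) &
        forall (U : set M) p, dopen U -> U p ->
          exists i, B i p /\ B i `<=` U].

Definition is_connected (M : dspace) : Prop :=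
  forall U : set M, dopen U -> dopen (~` U) -> U = set0 \/ U = setT.

End SmoothFunctions.

Section LinearDual.
Variables (R : realType) (V : lmodType R).

Definition functional : {pred V -> R} := fun f =>
  `[< forall (a : R) u v, f (a *: u + v) = a * f u + f v >].

Fact functional_submod : submod_closed functional.
Proof.
split=> [|a f g /asboolP lf /asboolP lg].
  by apply/asboolP => a u v; rewrite /GRing.zero /= mulr0 addr0.
by apply/asboolP => b u v; rewrite !fctE lf lg; rewrite /GRing.scale /=; ring.
Qed.
HB.instance Definition _ :=
  GRing.isSubmodClosed.Build R (V -> R) functional functional_submod.

Record ldual := LDual { ldual_fun :> V -> R; ldual_funP : ldual_fun \in functional }.
HB.instance Definition _ := [isSub for ldual_fun].
HB.instance Definition _ := [Choice of ldual by <:].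
HB.instance Definition _ := [SubChoice_isSubLmodule of ldual by <:].

Definition linearize (f : V -> R) : ldual := insubd (0 : ldual) f.

End LinearDual.

Section Kernel.
Variables (R : realType) (V : lmodType R) (a : ldual V).

Definition in_kerl : {pred V} := fun v => a v == 0.

Fact kerl_submod : submod_closed in_kerl.
Proof.
have /asboolP la := ldual_funP a.
have a0 : a 0 = 0 by have := la (-1) 0 0; rewrite scaler0 addr0 mulN1r addNr.
split=> [|b u v /eqP au /eqP av]; first by apply/eqP.
by apply/eqP; rewrite la au av mulr0 addr0.
Qed.
HB.instance Definition _ :=
  GRing.isSubmodClosed.Build R V in_kerl kerl_submod.

Record kerl := KerL { kerl_val :> V; kerlP : kerl_val \in in_kerl }.
HB.instance Definition _ := [isSub for kerl_val].
HB.instance Definition _ := [Choice of kerl by <:].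
HB.instance Definition _ := [SubChoice_isSubLmodule of kerl by <:].

End Kernel.

Section Tangent.
Variables (R : realType) (M : dspace R) (p : M).

(* Point derivations of the smooth functions; the last clause makes a tangent
   vector determined by its values on smooth functions. *)
Definition derivation (v : (M -> R) -> R) : Prop :=
  [/\ forall (a : R) f g, sm f -> sm g ->
        v (fun x => a * f x + g x) = a * v f + v g,
      forall f g, sm f -> sm g ->
        v (fun x => f x * g x) = f p * v g + g p * v f
    & forall f, ~ sm f -> v f = 0].

Definition tangent : {pred (M -> R) -> R} := fun v => `[< derivation v >].

Fact tangent_submod : submod_closed tangent.
Proof.
split=> [|a v w /asboolP[vl vm v0] /asboolP[wl wm w0]]; apply/asboolP; split.
- by move=> a f g _ _; rewrite /GRing.zero /= mulr0 addr0.
- by move=> f g _ _; rewrite /GRing.zero /= !mulr0 addr0.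
- by [].
- by move=> b f g sf sg; rewrite !fctE vl// wl// /GRing.scale /=; ring.
- by move=> f g sf sg; rewrite !fctE vm// wm// /GRing.scale /=; ring.
- by move=> f sf; rewrite !fctE v0// w0// scaler0 addr0.
Qed.
HB.instance Definition _ :=
  GRing.isSubmodClosed.Build R ((M -> R) -> R) tangent tangent_submod.

Record Tan := MkTan { tan_fun :> (M -> R) -> R; tan_funP : tan_fun \in tangent }.
HB.instance Definition _ := [isSub for tan_fun].
HB.instance Definition _ := [Choice of Tan by <:].
HB.instance Definition _ := [SubChoice_isSubLmodule of Tan by <:].

End Tangent.
Arguments Tan {R M} p.

Section Calculus.
Variable R : realType.
Implicit Types M N : dspace R.

(* The tangent map of f at p, with values in the tangent space at q; it is
   meaningful when q is equal to f p, possibly not definitionally. *)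
Definition dmap M N (f : M -> N) (p : M) (q : N) (v : Tan p) : Tan q :=
  insubd (0 : Tan q) (fun g => if `[< sm g >] then v (g \o f) else 0).

Definition tmap M N (f : M -> N) (p : M) (v : Tan p) : Tan (f p) :=
  dmap f (f p) v.

Definition surj_submersion M N (f : M -> N) : Prop :=
  [/\ smooth f, forall y, exists x, f x = y
    & forall p (w : Tan (f p)), exists v : Tan p, tmap f v = w].

Definition vfield M : Type := forall p : M, Tan p.

Definition smooth_vfield M (X : vfield M) : Prop :=
  forall f : M -> R, sm f -> sm (fun p => X p f).

Definition lie_bracket M (X Y : vfield M) : vfield M := fun p =>
  insubd (0 : Tan p) (fun f => X p (fun q => Y q f) - Y p (fun q => X q f)).

(* X and Y are f-related: X is f-projectable onto Y. *)
Definition related M N (f : M -> N) (X : vfield M) (Y : vfield N) : Prop :=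
  forall p, tmap f (X p) = Y (f p).

Definition form1 M : Type := forall p : M, ldual (Tan p).
Definition form2 M : Type := forall p : M, Tan p -> Tan p -> R.

Definition smooth_form2 M (w : form2 M) : Prop :=
  [/\ forall p (a : R) u u' v, w p (a *: u + u') v = a * w p u v + w p u' v,
      forall p u v, w p u v = - w p v u
    & forall X Y : vfield M, smooth_vfield X -> smooth_vfield Y ->
        sm (fun p => w p (X p) (Y p))].

Definition dfun M (f : M -> R) : form1 M := fun p =>
  linearize (fun v : Tan p => v f).

Definition pull1 M N (f : M -> N) (b : form1 N) : form1 M := fun p =>
  linearize (fun v : Tan p => b (f p) (tmap f v)).

Definition pull2 M N (f : M -> N) (w : form2 N) : form2 M := fun p u v =>
  w (f p) (tmap f u) (tmap f v).

Definition wedge M (a b : form1 M) : form2 M := fun p u v =>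
  a p u * b p v - a p v * b p u.

(* da(X, Y) = X(a(Y)) - Y(a(X)) - a([X, Y]), for any smooth extensions X and Y
   of the two tangent vectors. *)
Definition ext_d M (a : form1 M) : form2 M := fun p u v =>
  xget 0 [set r | exists X Y : vfield M,
    [/\ smooth_vfield X, smooth_vfield Y, X p = u, Y p = v &
        r = X p (fun q => a q (Y q)) - Y p (fun q => a q (X q))
            - a p (lie_bracket X Y p)]].

Definition dt : form1 (Rline R) := dfun (id : Rline R -> R).

Definition principal_R_bundle M N (pr : M -> N) (act : R -> M -> M) : Prop :=
  [/\ smooth pr,
      smooth (fun sx : prod_space (Rline R) M => act sx.1 sx.2 : M),
      (forall x, act 0 x = x) /\
        (forall s t x, act (s + t) x = act s (act t x))
    & forall y0 : N, exists U : set N, [/\ dopen U, U y0 &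
        exists T : prod_space (sub_space U) (Rline R) -> sub_space (pr @^-1` U),
          [/\ diffeo T,
              forall y s, pr (val (T (y, s))) = val y
            & forall y s t, val (T (y, s + t)) = act s (val (T (y, t)))]]].

Record lie_group := LieGroup {
  lie_sort :> groupType;
  lie_sm : set (lie_sort -> R);
  lie_smP : is_dstruct lie_sm;
  lie_space := DSpace lie_smP;
  lie_dim : nat;
  lie_manifold : is_manifold lie_dim lie_space;
  lie_mul_smooth : smooth (fun gh : prod_space lie_space lie_space =>
    (gh.1 * gh.2)%g : lie_space);
  lie_inv_smooth : smooth (fun g : lie_space => (g^-1)%g : lie_space) }.

Definition lie_alg (G : lie_group) := Tan (1%g : lie_space G).

Definition is_lie_action (G : lie_group) M (phi : G -> M -> M) : Prop :=
  [/\ smooth (fun gx : prod_space (lie_space G) M => phi gx.1 gx.2 : M),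
      forall x, phi 1%g x = x
    & forall g h x, phi (g * h)%g x = phi g (phi h x)].

Definition free_action (G : lie_group) (T : Type) (phi : G -> T -> T) : Prop :=
  forall g x, phi g x = x -> g = 1%g.

Definition inf_gen (G : lie_group) M (phi : G -> M -> M) (xi : lie_alg G)
    (x : M) : Tan x :=
  dmap (fun g : lie_space G => phi g x) x xi.

Definition Ad (G : lie_group) (g : G) (xi : lie_alg G) : lie_alg G :=
  dmap (fun k : lie_space G => (g * k * g^-1)%g : lie_space G)
    (1%g : lie_space G) xi.

Definition coAd (G : lie_group) (g : G) (nu : ldual (lie_alg G)) :
    ldual (lie_alg G) :=
  linearize (fun xi => nu (Ad g^-1%g xi)).

Definition coad_isotropy (G : lie_group) (nu : ldual (lie_alg G)) : set G :=
  [set g | coAd g nu = nu].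

End Calculus.
Arguments dmap {R M N} f {p} q v.

Section CotangentBundle.
Variables (R : realType) (Q : dspace R).

Record covector : Type := Covector {
  ct_base : Q; ct_fun : ldual (Tan ct_base) }.

Definition Tstar : dspace R := @gen_space R covector
  [set F | (exists2 f : Q -> R, sm f & F = fun a => f (ct_base a)) \/
           (exists2 X : vfield Q, smooth_vfield X
              & F = fun a => ct_fun a (X (ct_base a)))].

Definition pi_Q (a : Tstar) : Q := ct_base a.

Definition liouville : form1 Tstar := fun a =>
  linearize (fun w : Tan a => ct_fun a (tmap pi_Q w)).

Definition omega_Q : form2 Tstar := fun a u v => - ext_d liouville u v.

Definition ct_lift (G : lie_group R) (phi : G -> Q -> Q) (g : G) (a : Tstar) :
    Tstar :=
  @Covector (phi g (ct_base a))
    (linearize (fun u : Tan (phi g (ct_base a)) =>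
       ct_fun a (dmap (phi g^-1%g) (ct_base a) u))).

(* Tangent space at a of the orbit of a under the cotangent lift. *)
Definition orbit_tangent (G : lie_group R) (phi : G -> Q -> Q) (a : Tstar) :
    set (Tan a) :=
  range (fun xi : lie_alg G => inf_gen (ct_lift phi) xi a).

End CotangentBundle.
Arguments pi_Q {R Q} a.
Arguments liouville {R Q} p.
Arguments omega_Q {R Q} p u v.

Section HamiltonianSection.
Variables (R : realType) (Q : dspace R) (Pi : Q -> Rline R).

Definition eta_form : form1 Q := pull1 Pi (@dt R).

Definition Ver (q : Q) : lmodType R := kerl (eta_form q).

Record vcovector : Type := VCovector {
  v_base : Q; v_fun : ldual (Ver v_base) }.

Definition Vstar : dspace R := @gen_space R vcovector
  [set F | (exists2 f : Q -> R, sm f & F = fun b => f (v_base b)) \/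
           (exists2 X : forall q : Q, Ver q,
              smooth_vfield (fun q => val (X q) : Tan q)
              & F = fun b => v_fun b (X (v_base b)))].

Definition tau (b : Vstar) : Q := v_base b.

Definition mu (a : Tstar Q) : Vstar :=
  VCovector
    (linearize (fun u : Ver (ct_base a) => ct_fun a (val u))).

Definition psi (s : R) (a : Tstar Q) : Tstar Q :=
  @Covector R Q (ct_base a) (ct_fun a + s *: eta_form (ct_base a)).

Definition hamiltonian_section (h : Vstar -> Tstar Q) : Prop :=
  smooth h /\ forall b, mu (h b) = b.

(* F is the extended Hamiltonian of h: a - h (mu a) = F a *: eta. *)
Definition extended_hamiltonian (h : Vstar -> Tstar Q) (F : Tstar Q -> R) :
    Prop :=
  forall a, a = psi (F a) (h (mu a)).

Definition eta_0 : form1 (Tstar Q) := pull1 (Pi \o pi_Q) (@dt R).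

Definition Omega_h (h : Vstar -> Tstar Q) : form2 Vstar :=
  pull2 h omega_Q.

Definition omega_h (F : Tstar Q -> R) : form2 (Tstar Q) := fun a u v =>
  omega_Q a u v + wedge (dfun F) eta_0 u v.

Section Action.
Variables (G : lie_group R) (phi : G -> Q -> Q).

Definition eta_invariant : Prop := forall g, pull1 (phi g) eta_form = eta_form.

Definition v_lift (g : G) (b : Vstar) : Vstar :=
  @VCovector (phi g (v_base b))
    (linearize (fun u : Ver (phi g (v_base b)) =>
       v_fun b (insubd (0 : Ver (v_base b))
                   (dmap (phi g^-1%g) (v_base b) (val u : Tan _))))).

Definition equivariant_section (h : Vstar -> Tstar Q) : Prop :=
  forall g b, ct_lift phi g (h b) = h (v_lift g b).

(* F is the extended Hamiltonian, and m the morphism from G to R such that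
   Pi (phi g q) = Pi q + m g. *)
Definition momentum (F : Tstar Q -> R) (m : G -> R) (a : Tstar Q) :
    ldual (lie_alg G) :=
  linearize (fun xi => ct_fun a (inf_gen phi xi (ct_base a))
                       - F a * dfun (m : lie_space G -> R) 1%g xi).

End Action.
End HamiltonianSection.
Arguments eta_form {R Q} Pi p.
Arguments Omega_h {R Q Pi} h p u v.
Arguments omega_h {R Q} Pi F p u v.
Arguments tau {R Q} Pi b.
Arguments v_lift {R Q} Pi {G} phi g b.

(* The set N, with projection pr from the level set A, is the quotient of A by
   the action of the subgroup H of G. *)
Definition is_quotient (G T : Type) (act : G -> T -> T) (H : set G)
    (A : set T) (N : Type) (pr : set_type A -> N) : Prop :=
  (forall y, exists x, pr x = y) /\
  (forall x y, pr x = pr y <-> exists2 g, H g & val y = act g (val x)).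

(* Main.v *)
Require Import Defs.
From HB Require Import structures.
From mathcomp Require Import all_boot all_order all_algebra.
From mathcomp Require Import all_classical all_reals all_analysis.
From mathcomp Require Import ring lra.
Set Implicit Arguments.
Unset Strict Implicit.
Unset Printing Implicit Defensive.

Import Order.TTheory GRing.Theory Num.Theory numFieldNormedType.Exports.
Local Open Scope classical_set_scope.
Local Open Scope ring_scope.

(* On the cotangent bundle h o mu subtracts F_h times eta, so it pulls the
   Liouville form back to lambda_Q - F_h eta_0; as eta_0 is closed, it pulls
   omega_Q back to omega_h, that is mu^* Omega_h = omega_h.  Restricting to the
   level sets and using that pi_nu is a surjective submersion gives (i).

   For (ii), X = X_{F_h} satisfies eta_0(X) = 1, by pairing with the generator
   of the R-action psi, and hence i_X omega_h = 0.  So d = T mu (X) - R_h is in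
   ker Omega_h and in ker eta.  By the pullback formula, T h (d) is then in the
   kernel of omega_Q, which is nondegenerate; since mu o h = id, d = 0, and
   X is mu-projectable over R_h.  This passes to the quotients.

   Tangent vectors are point derivations, so all computations rest on local
   frames of Q and T^*Q: by Hadamard's lemma a derivation is determined by its
   values on coordinate functions, and bump functions make derivations local
   and extend tangent vectors to vector fields. *)

(** * Smooth functions on R^k *)

Section Calculus.
Variable R : realType.
Implicit Types k : nat.

(** The value of [ext_d] is chosen among those given by arbitrary smooth extensions of the two
    vectors, so nothing about [omega_Q], not even bilinearity, is available before a local formula
    shows that the extensions do not matter. Such a formula needs coordinates on the cotangent
    bundle and an extension of every tangent vector to a globally smooth field; this is the purpose
    of the cutoffs and of the globally defined frame fields. Naturality of d under pullback is
    replaced by a computation in canonical coordinates, where closedness of eta_0 becomes the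
    symmetry of second derivatives of Pi.

    No chart of the dual vertical bundle is constructed: its tangent vectors are tested on the
    generating functions, and the kernel argument is carried by [h] to the cotangent bundle, where
    coordinates exist.

    A second obstacle is typing: base points such as [h (mu Pi (h b))] and [h b] are only
    propositionally equal, hence so are their tangent spaces. This is why tangent maps appear mostly
    as [dmap], with an explicit target point. *)

Lemma Cdiff_cont k j (W : set 'rV[R]_k) u x :
  Cdiff j W u -> W x -> {for x, continuous u}.
Proof. by case: j => [|j] [cu _]; exact: cu. Qed.

Lemma Cdiff_pred k j (W : set 'rV[R]_k) u : Cdiff j.+1 W u -> Cdiff j W u.
Proof.
elim: j u => [|j ih] u [cu du]; split=> // i; have [du1 du2] := du i.
by split=> //; exact: ih.
Qed.

Lemma Cdiff_derivable k j (W : set 'rV[R]_k) u i x :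
  Cdiff j.+1 W u -> W x -> derivable u x (delta_mx 0 i).
Proof. by move=> [_ /(_ i)[]] du _ Wx; exact: du. Qed.

Arguments Cdiff_derivable {k j W u} i {x}.

Lemma Cdiff_derive k j (W : set 'rV[R]_k) u i :
  Cdiff j.+1 W u -> Cdiff j W ('D_(delta_mx 0 i) u).
Proof. by move=> [_ /(_ i)[]]. Qed.

Lemma Cdiff_subset k j (W W' : set 'rV[R]_k) u :
  W' `<=` W -> Cdiff j W u -> Cdiff j W' u.
Proof.
move=> sW; elim: j u => [|j ih] u [cu du]; split=> //.
- by move=> x /sW; exact: cu.
- by move=> x /sW; exact: cu.
move=> i; have [du1 du2] := du i; split; first by move=> x /sW; exact: du1.
exact: ih.
Qed.

(** The conditions in [Cdiff] are those of the total function at the points of the set, so they can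
    be checked point by point. *)
Lemma Cdiff_bigcup k j (W : set 'rV[R]_k) u :
  (forall x, W x -> exists2 V, V x & Cdiff j V u) -> Cdiff j W u.
Proof.
elim: j u => [|j ih] u Wu.
  by split=> // x /Wu[V Vx /Cdiff_cont]; exact.
split; first by move=> x /Wu[V Vx /Cdiff_cont]; exact.
move=> i; split; first by move=> x /Wu[V Vx /Cdiff_derivable]; exact.
by apply: ih => x /Wu[V Vx /(Cdiff_derive i) du]; exists V.
Qed.

Lemma near_eq_continuous_at (T U : topologicalType) (f g : T -> U) (x : T) :
  {near x, f =1 g} -> {for x, continuous f} -> {for x, continuous g}.
Proof.
move=> fg; rewrite /prop_for/continuous_at -(nbhs_singleton fg) => cf.
by apply: cvg_trans cf; exact: near_eq_cvg.
Qed.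

Lemma open_near_eq (T : topologicalType) (U : Type) (W : set T) (f g : T -> U) x :
  open W -> (forall y, W y -> f y = g y) -> W x -> {near x, f =1 g}.
Proof.
by move=> oW fg Wx; apply: filterS (open_nbhs_nbhs (conj oW Wx)) => y /fg.
Qed.

Lemma eq_Cdiff k j (W : set 'rV[R]_k) u v : open W ->
  (forall x, W x -> u x = v x) -> Cdiff j W u -> Cdiff j W v.
Proof.
move=> oW; elim: j u v => [|j ih] u v uv [cu du].
  split=> // x Wx; apply: near_eq_continuous_at (cu x Wx).
  exact: open_near_eq oW uv Wx.
split=> [x Wx|i].
  apply: near_eq_continuous_at (cu x Wx); exact: open_near_eq oW uv Wx.
have [du1 du2] := du i; split.
  move=> x Wx; apply: near_eq_derivable (du1 x Wx).
  exact: open_near_eq oW uv Wx.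
apply: ih du2 => x Wx; apply: near_eq_derive; exact: open_near_eq oW uv Wx.
Qed.

Lemma Cdiff_cst k j (W : set 'rV[R]_k) (c : R) : Cdiff j W (fun=> c).
Proof.
elim: j c => [|j ih] c; split=> //.
- by move=> x _; exact: cst_continuous.
- by move=> x _; exact: cst_continuous.
move=> i; split; first by move=> x _; exact: derivable_cst.
have -> : 'D_(delta_mx 0 i) (fun=> c) = (fun=> 0) :> ('rV[R]_k -> R).
  by apply/funext => x; exact: derive_cst.
exact: ih.
Qed.

Lemma CdiffD k j (W : set 'rV[R]_k) u v : open W ->
  Cdiff j W u -> Cdiff j W v -> Cdiff j W (fun x => u x + v x).
Proof.
move=> oW; elim: j u v => [|j ih] u v Cu Cv.
  split=> // x Wx.
  exact: (continuousD (Cdiff_cont Cu Wx) (Cdiff_cont Cv Wx)).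
split=> [x Wx|i].
  exact: (continuousD (Cdiff_cont Cu Wx) (Cdiff_cont Cv Wx)).
split=> [x Wx|].
  exact: (derivableD (Cdiff_derivable i Cu Wx) (Cdiff_derivable i Cv Wx)).
apply: (eq_Cdiff oW _ (ih _ _ (Cdiff_derive i Cu) (Cdiff_derive i Cv))) => x Wx.
exact/esym/(deriveD (Cdiff_derivable i Cu Wx) (Cdiff_derivable i Cv Wx)).
Qed.

Lemma CdiffM k j (W : set 'rV[R]_k) u v : open W ->
  Cdiff j W u -> Cdiff j W v -> Cdiff j W (fun x => u x * v x).
Proof.
move=> oW; elim: j u v => [|j ih] u v Cu Cv.
  split=> // x Wx.
  exact: (continuousM (Cdiff_cont Cu Wx) (Cdiff_cont Cv Wx)).
split=> [x Wx|i].
  exact: (continuousM (Cdiff_cont Cu Wx) (Cdiff_cont Cv Wx)).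
split=> [x Wx|].
  exact: (derivableM (Cdiff_derivable i Cu Wx) (Cdiff_derivable i Cv Wx)).
have := CdiffD oW (ih _ _ (Cdiff_pred Cu) (Cdiff_derive i Cv))
  (ih _ _ (Cdiff_pred Cv) (Cdiff_derive i Cu)).
apply: (eq_Cdiff oW) => x Wx.
exact/esym/(deriveM (Cdiff_derivable i Cu Wx) (Cdiff_derivable i Cv Wx)).
Qed.

Lemma Cdiff_sum k j (W : set 'rV[R]_k) (I : Type) (r : seq I) (P : pred I)
    (u : I -> 'rV[R]_k -> R) : open W ->
  (forall i, Cdiff j W (u i)) -> Cdiff j W (fun x => \sum_(i <- r | P i) u i x).
Proof.
move=> oW Cu; elim: r => [|a r ih].
  rewrite (_ : (fun _ => _) = fun=> 0); first exact: Cdiff_cst.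
  by apply/funext => x; rewrite big_nil.
rewrite (_ : (fun _ => _) = fun x =>
    (if P a then u a x else 0) + \sum_(i <- r | P i) u i x); last first.
  by apply/funext => x; rewrite big_cons; case: ifP; rewrite // add0r.
by apply: CdiffD => //; case: (P a) => //; exact: Cdiff_cst.
Qed.

Lemma is_derive_coord k (i : 'I_k) (x v : 'rV[R]_k) :
  is_derive x v (fun y : 'rV[R]_k => y 0 i) (v 0 i).
Proof.
have xd : derivable (id : 'rV[R]_k -> _) x v by exact: derivable_id.
apply: DeriveDef; first by move/derivable_mxP : xd; exact.
by have := derive_mx xd; rewrite derive_id => /rowP/(_ i); rewrite !mxE.
Qed.
Arguments is_derive_coord {k} i x v.

Lemma Cdiff_coord k j (W : set 'rV[R]_k) i : Cdiff j W (fun x => x 0 i).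
Proof.
have cx x : {for x, continuous (fun x : 'rV[R]_k => x 0 i)}.
  exact: coord_continuous.
have dx (x v : 'rV[R]_k) := is_derive_coord i x v.
case: j => [|j]; split=> // l; split=> [x Wx|].
  exact: (@ex_derive _ _ _ _ _ _ _ (dx x _)).
rewrite (_ : (fun _ => _) = (fun=> (delta_mx 0 l : 'rV[R]_k) 0 i)).
  exact: Cdiff_cst.
by apply/funext => x; apply: (@derive_val _ _ _ _ _ _ _ (dx x _)).
Qed.

(** * Mean value theorem and chain rule *)

Lemma MVT_abs (f df : R -> R) (a b : R) :
  (forall s, `|s - a| <= `|b - a| -> is_derive s 1 f (df s)) ->
  exists2 c, `|c - a| <= `|b - a| & f b - f a = df c * (b - a).
Proof.
move=> fd; have fc s : `|s - a| <= `|b - a| -> {for s, continuous f}.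
  by move=> /fd ds; apply/differentiable_continuous/derivable1_diffP.
have [ab|/ltW ba] := leP a b.
  have H s : s \in `[a, b]%R -> `|s - a| <= `|b - a|.
    by rewrite in_itv/= => /andP[as1 sb]; rewrite !ger0_norm ?subr_ge0//; lra.
  have [s sab||c /H ? ?] := @MVT_segment _ f df a b ab; last by exists c.
    by apply/fd/H/subset_itv_oo_cc.
  apply: continuous_in_subspaceT => s; rewrite inE/= => /H; exact: fc.
have H s : s \in `[b, a]%R -> `|s - a| <= `|b - a|.
  by rewrite in_itv/= => /andP[as1 sb]; rewrite !ler0_norm ?subr_le0//; lra.
have [s sab||c /H ? E] := @MVT_segment _ f df b a ba.
- by apply/fd/H/subset_itv_oo_cc.
- by apply: continuous_in_subspaceT => s; rewrite inE/= => /H; exact: fc.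
by exists c => //; rewrite -opprB E; ring.
Qed.

Lemma is_derive_line k (u : 'rV[R]_k -> R) (x v : 'rV[R]_k) (s : R) :
  derivable u (s *: v + x) v ->
  is_derive s 1 (fun t => u (t *: v + x)) ('D_v u (s *: v + x)).
Proof.
move=> du; have E : (fun h : R => h^-1 *: (((fun t => u (t *: v + x)) \o shift s)
    (h *: 1) - u (s *: v + x))) =
    (fun h => h^-1 *: ((u \o shift (s *: v + x)) (h *: v) - u (s *: v + x))).
  by apply/funext => h /=; rewrite [h *: 1]mulr1 scalerDl addrA.
by apply: DeriveDef; rewrite /derivable/derive/= E.
Qed.

(* Mean value theorem along the polygonal path from x to y that changes one
   coordinate at a time. *)
Lemma MVT_rV k (W : set 'rV[R]_k) (u : 'rV[R]_k -> R) (x y : 'rV[R]_k) :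
  (forall z : 'rV[R]_k, (forall i, `|z 0 i - x 0 i| <= `|y 0 i - x 0 i|) -> W z) ->
  (forall i z, W z -> derivable u z (delta_mx 0 i)) ->
  exists xi : 'I_k -> 'rV[R]_k,
    (forall l i, `|xi l 0 i - x 0 i| <= `|y 0 i - x 0 i|) /\
    u y - u x = \sum_l 'D_(delta_mx 0 l) u (xi l) * (y 0 l - x 0 l).
Proof.
move=> Wz du.
pose p (j : nat) : 'rV[R]_k := \row_i (if (i < j)%N then y 0 i else x 0 i).
have step (l : 'I_k) : exists z : 'rV[R]_k,
    (forall i, `|z 0 i - x 0 i| <= `|y 0 i - x 0 i|) /\
    u (p l.+1) - u (p l) = 'D_(delta_mx 0 l) u z * (y 0 l - x 0 l).
  pose q s := s *: delta_mx 0 l + p l.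
  have qE s i : q s 0 i = if i == l then s + x 0 l else p l 0 i.
    rewrite !mxE eqxx/=; case: eqVneq => [->|_]; first by rewrite ltnn mulr1.
    by rewrite mulr0 add0r.
  have qW s : `|s - 0| <= `|(y 0 l - x 0 l) - 0| ->
      forall i, `|q s 0 i - x 0 i| <= `|y 0 i - x 0 i|.
    rewrite !subr0 => sl i; rewrite qE; case: eqVneq => [->|_].
      by rewrite addrK.
    by rewrite mxE; case: ifP => // _; rewrite subrr normr0.
  have [s|c cl E] := @MVT_abs (u \o q) ('D_(delta_mx 0 l) u \o q) 0 (y 0 l - x 0 l).
    by move=> /qW qs; apply: is_derive_line; apply/du/Wz.
  exists (q c); split; first exact: qW.
  move: E; rewrite /= subr0 => <-; congr (u _ - u _); apply/rowP => i.
    rewrite qE mxE ltnS; case: eqVneq => [->|il]; first by rewrite leqnn subrK.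
    by rewrite mxE ltn_neqAle (inj_eq val_inj) il.
  by rewrite qE; case: eqVneq => [->|//]; rewrite mxE ltnn add0r.
have [xi xiP] := choice step; exists xi; split=> [l|]; first by have [] := xiP l.
have -> : y = p k by apply/rowP => i; rewrite mxE ltn_ord.
have -> : u x = u (p 0%N) by congr u; apply/rowP => i; rewrite mxE.
rewrite -(telescope_sumr (u \o p))// big_mkord; apply: eq_bigr => l _ /=.
by have [_ ->] := xiP l; rewrite mxE ltn_ord.
Qed.

Lemma cvg_rV (T : Type) (F : set_system T) (FF : Filter F) k
    (g : T -> 'rV[R]_k) (a : 'rV[R]_k) :
  (forall i, g t 0 i @[t --> F] --> a 0 i) -> g t @[t --> F] --> a.
Proof.
move=> ga; apply/cvg_ballP => e e0.
have : \forall t \near F, forall i, ball (a 0 i) e (g t 0 i).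
  by apply: filter_forall => i; move/cvg_ballP : (ga i); exact.
by apply: filterS => t gt; split=> // i j; rewrite ord1.
Qed.

Lemma continuous_row_at (T : topologicalType) k (f : 'I_k -> T -> R) x :
  (forall i, {for x, continuous (f i)}) ->
  {for x, continuous (fun x => \row_i f i x)}.
Proof.
move=> cf; apply: cvg_rV => i; rewrite mxE.
by under eq_fun do rewrite mxE; exact: cf.
Qed.

Lemma derivable_line_cvg (V : normedModType R) (f : V -> R) x v :
  derivable f x v -> f (h *: v + x) @[h --> (0 : R)^'] --> f x.
Proof.
move=> /derivable1P /derivable1_diffP /differentiable_continuous cf.
apply: cvg_trans (_ : f (h *: v + x) @[h --> (0 : R)] --> f x).
  by apply: cvg_app; exact: nbhs_dnbhs.
by have := cf; rewrite /prop_for/continuous_at scale0r add0r.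
Qed.

(** By the mean value theorem the increment of u is a sum of partial derivatives at intermediate
    points times increments of the f i. The intermediate points tend to the base point, where the
    partial derivatives are continuous. The f i are only assumed derivable in the direction v. *)
Lemma derive_comp_row k n (W : set 'rV[R]_k) (u : 'rV[R]_k -> R)
    (f : 'I_k -> 'rV[R]_n -> R) (x v : 'rV[R]_n) :
  open W -> W (\row_i f i x) -> Cdiff 1 W u ->
  (forall i, derivable (f i) x v) ->
  is_derive x v (fun z => u (\row_i f i z))
    (\sum_i 'D_(delta_mx 0 i) u (\row_i f i x) * 'D_v (f i) x).
Proof.
move=> oW Wx Cu df; set a := \row_i f i x.
have [e /= e0 eW] : exists2 e : R, 0 < e & ball a e `<=` W.
  by have /nbhs_ballP[e ? ?] := open_nbhs_nbhs (conj oW Wx); exists e.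
(* Smallness of the increments is a premise inside the existential, so that [choice] applies to all
   h; for other h the points are arbitrary. *)
have step h : exists xi : 'I_k -> 'rV[R]_k,
    (forall i, `|f i (h *: v + x) - f i x| < e) ->
    (forall l i, `|xi l 0 i - a 0 i| <= `|f i (h *: v + x) - f i x|) /\
    u (\row_i f i (h *: v + x)) - u a =
      \sum_l 'D_(delta_mx 0 l) u (xi l) * (f l (h *: v + x) - f l x).
  have [he|] := pselect (forall i, `|f i (h *: v + x) - f i x| < e); last first.
    by exists (fun=> 0).
  have [z zP|i z|xi [xi1 xi2]] :=
      @MVT_rV k W u a (\row_i f i (h *: v + x)).
  - apply: eW; split=> // i j; rewrite ord1 {i}/ball/= distrC (le_lt_trans (zP _))//.
    by rewrite !mxE.
  - by move=> Wz; exact: Cdiff_derivable Cu Wz.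
  exists xi => _; split=> [l i|]; first by have := xi1 l i; rewrite !mxE.
  by rewrite xi2; apply: eq_bigr => l _; rewrite !mxE.
have [xi xiP] := choice step.
have fv i : f i (h *: v + x) - f i x @[h --> (0 : R)^'] --> 0.
  have := cvgB (derivable_line_cvg (df i)) (@cvg_cst _ (f i x) _ (0 : R)^' _).
  by rewrite subrr; exact.
have nearh : \forall h \near (0 : R)^', forall i, `|f i (h *: v + x) - f i x| < e.
  apply: filter_forall => i; have /cvgrPdist_lt/(_ _ e0) := fv i.
  by apply: filterS => h; rewrite sub0r normrN.
have xia l : xi h l @[h --> (0 : R)^'] --> a.
  apply: cvg_rV => i; apply/cvgrPdist_lt => d d0.
  have /cvgrPdist_lt/(_ _ d0) := fv i; apply: filterS2 nearh => h he.
  rewrite sub0r normrN => fd; rewrite distrC; have [/(_ l i) xih _] := xiP h he.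
  exact: le_lt_trans xih fd.
have H : h^-1 *: (((fun z => u (\row_i f i z)) \o shift x) (h *: v) - u a)
    @[h --> (0 : R)^'] -->
    \sum_i 'D_(delta_mx 0 i) u a * 'D_v (f i) x.
  have : \sum_l 'D_(delta_mx 0 l) u (xi h l) *
      (h^-1 *: ((f l \o shift x) (h *: v) - f l x)) @[h --> (0 : R)^'] -->
    \sum_i 'D_(delta_mx 0 i) u a * 'D_v (f i) x.
    apply: cvg_big => [|l _]; first exact: add_continuous.
    apply: cvgM; last exact: df.
    apply: (cvg_comp (xi ^~ l) ('D_(delta_mx 0 l) u) (xia l)).
    exact: (Cdiff_cont (Cdiff_derive l Cu) Wx).
  apply: cvg_trans; apply: near_eq_cvg; apply: filterS nearh => h he /=.
  have [_ ->] := xiP h he; rewrite scaler_sumr; apply: eq_bigr => l _.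
  by rewrite /GRing.scale/=; ring.
apply: DeriveDef; last exact: cvg_lim H.
by apply/cvg_ex; eexists; exact: H.
Qed.

(** Induction on j for varying u: each derivative is a sum of products of a partial derivative of u
    composed with the f i, covered by the induction hypothesis, and a derivative of some f i. *)
Lemma Cdiff_comp k n j (W : set 'rV[R]_k) (V : set 'rV[R]_n)
    (u : 'rV[R]_k -> R) (f : 'I_k -> 'rV[R]_n -> R) :
  open W -> open V -> (forall x, V x -> W (\row_i f i x)) ->
  Cdiff j W u -> (forall i, Cdiff j V (f i)) ->
  Cdiff j V (fun x => u (\row_i f i x)).
Proof.
move=> oW oV fVW.
have cf l u' (f' : 'I_k -> 'rV[R]_n -> R) :
    (forall x, V x -> W (\row_i f' i x)) -> Cdiff l W u' ->
    (forall i, Cdiff l V (f' i)) -> forall x, V x ->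
    {for x, continuous (fun x => u' (\row_i f' i x))}.
  move=> fVW' Cu Cf x Vx.
  apply: (@continuous_comp _ _ _ (fun x => \row_i f' i x) u'); last first.
    by apply: (Cdiff_cont Cu); exact: fVW'.
  by apply: continuous_row_at => i; exact: (Cdiff_cont (Cf i) Vx).
elim: j u => [|j ih] u Cu Cf; first by split=> //; exact: (cf 0%N).
split; first exact: (cf j.+1).
have C1 i (w : 'rV[R]_k -> R) : Cdiff i.+1 W w -> Cdiff 1 W w.
  by elim: i => // i ih' /Cdiff_pred.
have D l x (Vx : V x) := derive_comp_row oW (fVW x Vx) (C1 _ _ Cu)
  (fun i => Cdiff_derivable l (Cf i) Vx).
move=> l; split=> [x Vx|]; first by have [] := D l x Vx.
apply: (@eq_Cdiff _ _ _ (fun x => \sum_i 'D_(delta_mx 0 i) u (\row_i f i x) *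
    'D_(delta_mx 0 l) (f i) x)) => //.
  by move=> x Vx; have [_ ->] := D l x Vx.
apply: Cdiff_sum => // i; apply: CdiffM => //; last exact: Cdiff_derive.
by apply: (ih _ (Cdiff_derive i Cu)) => i'; exact: Cdiff_pred.
Qed.

End Calculus.
Arguments is_derive_coord {R k} i x v.
Arguments Cdiff_derivable {R k j W u} i {x}.

(** * Integrals depending on a parameter *)

Section Param.
Variable R : realType.

Definition int01 (g : R -> R) : R :=
  \int[@lebesgue_measure R]_(t in `[0, 1]) g t.

Lemma integrable01 (g : R -> R) : continuous g ->
  (@lebesgue_measure R).-integrable `[0, 1] (EFin \o g).
Proof.
move=> cg; apply: continuous_compact_integrable; first exact: segment_compact.
exact: continuous_subspaceT.
Qed.

Lemma int01D (f g : R -> R) : continuous f -> continuous g ->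
  int01 (fun t => f t + g t) = int01 f + int01 g.
Proof. by move=> cf cg; rewrite /int01 RintegralD//; exact: integrable01. Qed.

Lemma int01Z (c : R) (g : R -> R) : continuous g ->
  int01 (fun t => c * g t) = c * int01 g.
Proof. by move=> cg; rewrite /int01 RintegralZl//; exact: integrable01. Qed.

Lemma norm_int01_le (g : R -> R) (e : R) : continuous g ->
  (forall t, 0 <= t <= 1 -> `|g t| <= e) -> `|int01 g| <= e.
Proof.
move=> cg ge; apply: le_trans (le_normr_Rintegral _ (integrable01 cg)) _ => //.
have cn : continuous (fun t => `|g t|).
  by move=> t; apply: cvg_norm; exact: cg.
have ce : continuous (fun _ : R => e) by move=> t; exact: cvg_cst.
apply: (@le_trans _ _ (int01 (fun=> e))).
  apply: (@le_Rintegral _ _ _ lebesgue_measure); first by [].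
  - exact: integrable01 cn.
  - exact: integrable01 ce.
  - by move=> t /=; rewrite in_itv/=; exact: ge.
rewrite /int01 Rintegral_cst//= lebesgue_measure_itv/= lte01/=.
by rewrite oppr0 addr0 mulr1.
Qed.

Lemma int01_FTC (f F : R -> R) : continuous f ->
  (forall t : R, is_derive t 1 F (f t)) -> int01 f = F 1 - F 0.
Proof.
move=> cf dF; have cF (t : R) : {for t, continuous F}.
  by apply/differentiable_continuous/derivable1_diffP; have [] := dF t.
rewrite /int01 /Rintegral (@continuous_FTC2 _ f F)//.
- exact: continuous_subspaceT.
- split=> [t _||]; first by have [] := dF t.
  + apply: cvg_at_right_filter; exact: cF.
  + apply: cvg_at_left_filter; exact: cF.
- by move=> t _; rewrite derive1E; have [_ ->] := dF t.
Qed.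

(** Compactness of [0, 1] turns continuity in both variables into uniformity in t. The bound e / 2
    is used twice, to compare the values at y and at x with one value at x. *)
Lemma near_uniform01 (T : topologicalType) (F : T -> R -> R) (x : T) (e : R) :
  continuous (fun z : T * R => F z.1 z.2) -> 0 < e ->
  \forall y \near x, forall t, 0 <= t <= 1 -> `|F y t - F x t| < e.
Proof.
move=> cF e0; have := @segment_compact R 0 1.
move=> /compact_near_coveringP/(_ T (nbhs x) (fun y t => `|F y t - F x t| < e)).
move=> H; have {}H : \forall y \near x, `[0, 1] `<=` [set t | `|F y t - F x t| < e].
  apply: H => t _.
  have e2 : 0 < e / 2 by rewrite divr_gt0.
  have := cF (x, t) => /cvgrPdist_lt/(_ _ e2) [[A B] /= [xA tB] AB].
  exists (B, A) => // -[s y] /= [Bs Ay].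
  have h1 := AB (y, s) (conj Ay Bs); have h2 := AB (x, s) (conj (nbhs_singleton xA) Bs).
  rewrite (_ : _ - _ = (F x t - F x s) - (F x t - F y s)); last by ring.
  by rewrite (le_lt_trans (ler_normB _ _))// (splitr e) ltrD.
by apply: filterS H => y H t t01; apply: H; rewrite /= in_itv.
Qed.

Lemma continuous_fctD (T : topologicalType) (f g : T -> R) :
  continuous f -> continuous g -> continuous (fun t => f t + g t).
Proof. by move=> cf cg t; exact: (continuousD (cf t) (cg t)). Qed.

Lemma continuous_fctZ (T : topologicalType) (c : R) (g : T -> R) :
  continuous g -> continuous (fun t => c * g t).
Proof.
by move=> cg t; exact: (continuousM (@cst_continuous _ _ c t) (cg t)).
Qed.

Lemma continuous_section (T : topologicalType) (F : T -> R -> R) (x : T) :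
  continuous (fun z : T * R => F z.1 z.2) -> continuous (F x).
Proof.
move=> cF t; apply: (@continuous_comp _ _ _ (fun t => (x, t)) (fun z => F z.1 z.2)).
  move=> A [[B C]/= [xB tC] BC]; rewrite /nbhs/=; apply: filterS tC => s Cs.
  by apply: (BC (x, s)); split=> //; exact: nbhs_singleton xB.
exact: (cF (x, t)).
Qed.

Lemma continuous_int01 (T : topologicalType) (F : T -> R -> R) :
  continuous (fun z : T * R => F z.1 z.2) ->
  continuous (fun x => int01 (F x)).
Proof.
move=> cF x; apply/cvgrPdist_le => e e0.
apply: filterS (near_uniform01 x cF e0) => y Fy.
rewrite distrC (_ : _ - _ = int01 (fun t => F y t + -1 * F x t)).
  apply: norm_int01_le => [t|t /Fy /ltW]; last by rewrite mulN1r.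
  by apply: continuous_fctD; [|apply: continuous_fctZ]; exact: continuous_section.
rewrite int01D ?int01Z ?mulN1r//; try exact: continuous_section.
by apply: continuous_fctZ; exact: continuous_section.
Qed.

(** The mean value theorem writes the difference quotient of the integrand as dF at an intermediate
    parameter, which is uniformly close to dF at a by [near_uniform01]. *)
Lemma is_derive_int01 (F dF : R -> R -> R) (a : R) :
  (forall s, continuous (F s)) -> continuous (fun z : R * R => dF z.1 z.2) ->
  (forall s t : R, is_derive s 1 (F ^~ t) (dF s t)) ->
  is_derive a 1 (fun s => int01 (F s)) (int01 (dF a)).
Proof.
move=> cF cdF FdF.
suff H : h^-1 *: (((fun s => int01 (F s)) \o shift a) (h *: 1) - int01 (F a))
    @[h --> (0 : R)^'] --> int01 (dF a).
  by apply: DeriveDef; [apply/cvg_ex; eexists; exact: H|exact: cvg_lim H].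
apply/cvgrPdist_le => e e0.
have := near_uniform01 a cdF e0.
move=> /nbhs_ballP[d /= d0 dP].
have : \forall h \near (0 : R)^', `|h| < d /\ h != 0.
  near=> h; split; near: h; first exact: dnbhs0_lt.
  exact: nbhs_dnbhs_neq.
apply: filterS => h [hd h0] /=.
have cS s c : continuous (fun t => c * F s t).
  exact: continuous_fctZ.
have cdFa : continuous (dF a) by exact: continuous_section.
rewrite [h *: 1]mulr1 -normrN opprB.
rewrite (_ : _ - _ = int01 (fun t => h^-1 * F (h + a) t +
    (- h^-1 * F a t + -1 * dF a t))).
  apply: norm_int01_le => [t|t t01].
    by do 2 apply: continuous_fctD => //; exact: continuous_fctZ.
  have [c] := @MVT_abs _ (F ^~ t) (dF ^~ t) a (h + a) (fun s _ => FdF s t).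
  rewrite addrK => ch Fc.
  rewrite (_ : _ + _ = dF c t - dF a t).
    apply/ltW/dP => //; rewrite /ball/= distrC; exact: le_lt_trans ch hd.
  have -> : dF c t = h^-1 * (F (h + a) t - F a t) by rewrite Fc mulrC mulfK.
  by ring.
rewrite !int01D ?int01Z//.
- by rewrite /GRing.scale/=; ring.
- exact: continuous_fctZ.
- by apply: continuous_fctD => //; exact: continuous_fctZ.
Unshelve. all: end_near. Qed.

End Param.

(** * Hadamard's lemma *)

Section Hadamard.
Variable R : realType.

Lemma continuous_pair_at (T U V : topologicalType) (f : T -> U) (g : T -> V) x :
  {for x, continuous f} -> {for x, continuous g} ->
  {for x, continuous (fun y => (f y, g y))}.
Proof.
move=> cf cg A [[B C] /= [xB xC] BC].
have fB : nbhs x (f @^-1` B) by exact: cf.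
have gC : nbhs x (g @^-1` C) by exact: cg.
apply: (filterS _ (filterI fB gC)) => y [By Cy].
by apply: (BC (_, _)).
Qed.

Lemma is_derive_line0 (V : normedModType R) (u : V -> R) (x v : V) d :
  is_derive (0 : R) 1 (fun t : R => u (t *: v + x)) d -> is_derive x v u d.
Proof.
have E : (fun h : R => h^-1 *: (((fun t : R => u (t *: v + x)) \o shift (0 : R))
    (h *: 1) - u ((0 : R) *: v + x))) =
    (fun h : R => h^-1 *: ((u \o shift x) (h *: v) - u x)).
  by apply/funext => h /=; rewrite [h *: 1]mulr1 scale0r add0r addr0.
by move=> [H1 H2]; apply: DeriveDef; move: H1 H2; rewrite /derivable/derive/= E.
Qed.

Lemma int01_sum n (f : 'I_n -> R -> R) (c : 'I_n -> R) :
  (forall i, continuous (f i)) ->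
  continuous (fun t => \sum_i c i * f i t) /\
  int01 (fun t => \sum_i c i * f i t) = \sum_i c i * int01 (f i).
Proof.
move=> cf; elim: (index_enum _) => [|i r [cr ih]].
  have E : (fun t => \sum_(i <- [::]) c i * f i t) = fun=> 0.
    by apply/funext => t; rewrite big_nil.
  rewrite big_nil E; split=> [t|]; first exact: cvg_cst.
  by rewrite /int01 Rintegral_cst// mul0r.
have E : (fun t => \sum_(i <- i :: r) c i * f i t) =
    fun t => c i * f i t + \sum_(i <- r) c i * f i t.
  by apply/funext => t; rewrite big_cons.
have ci : continuous (fun t => c i * f i t) by exact: continuous_fctZ.
by rewrite big_cons E; split; [exact: continuous_fctD|rewrite int01D// int01Z// ih].
Qed.

(** A coinduction principle for smoothness: a family of continuous functions closed under partial
    derivatives on W consists of smooth functions, so explicit higher derivatives never have to be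
    computed. *)
Lemma Cinf_stable k (W : set 'rV[R]_k) (S : set ('rV[R]_k -> R)) : open W ->
  (forall u x, S u -> W x -> {for x, continuous u}) ->
  (forall u i, S u -> exists2 v, S v &
     forall x, W x -> is_derive x (delta_mx 0 i) u (v x)) ->
  S `<=` Cinf W.
Proof.
move=> oW cS dS u Su j; elim: j u Su => [|j ih] u Su.
  by split=> // x; exact: cS.
split=> [x|i]; first exact: cS.
have [v Sv uv] := dS u i Su; split=> [x /uv []//|].
by apply: (eq_Cdiff oW _ (ih _ Sv)) => x /uv [_ ->].
Qed.

Lemma is_derive_C1 k (W : set 'rV[R]_k) u x v : open W -> W x -> Cdiff 1 W u ->
  is_derive x v u (\sum_i 'D_(delta_mx 0 i) u x * v 0 i).
Proof.
move=> oW Wx Cu.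
have xE (y : 'rV[R]_k) : \row_i y 0 i = y by apply/rowP => i; rewrite mxE.
have dx (i : 'I_k) := is_derive_coord i x v.
have := @derive_comp_row R k k W u (fun i y => y 0 i) x v oW.
rewrite xE => /(_ Wx Cu (fun i => @ex_derive _ _ _ _ _ _ _ (dx i))).
under eq_fun do rewrite xE.
by under eq_bigr => i _ do rewrite (@derive_val _ _ _ _ _ _ _ (dx i)).
Qed.

Lemma Cinf_cont k (W : set 'rV[R]_k) u x : Cinf W u -> W x -> {for x, continuous u}.
Proof. by move=> /(_ 0%N)/Cdiff_cont; exact. Qed.

Lemma Cinf_derive k (W : set 'rV[R]_k) u i : Cinf W u ->
  Cinf W ('D_(delta_mx 0 i) u).
Proof. by move=> Cu j; apply: Cdiff_derive (Cu j.+1). Qed.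

(** The restriction of f to the segment from p to x, weighted by a power of t. The coefficients in
    Hadamard's lemma are its integrals for j = 0 and f a partial derivative. *)
Definition radial k (p : 'rV[R]_k) (j : nat) (f : 'rV[R]_k -> R)
    (x : 'rV[R]_k) (t : R) : R := t ^+ j * f (t *: (x - p) + p).

Lemma continuous_radial k (p : 'rV[R]_k) j f : continuous f ->
  continuous (fun z : 'rV[R]_k * R => radial p j f z.1 z.2).
Proof.
move=> cf z; apply: (@continuousM _ _ (fun z : 'rV[R]_k * R => z.2 ^+ j)
    (fun z : 'rV[R]_k * R => f (z.2 *: (z.1 - p) + p))).
  apply: (@continuous_comp _ _ _ snd (fun t : R => t ^+ j)).
    exact: cvg_snd.
  exact: exprn_continuous.
apply: (@continuous_comp _ _ _ (fun z : 'rV[R]_k * R => z.2 *: (z.1 - p) + p) f);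
  last exact: cf.
apply: continuousD; last exact: cvg_cst.
apply: (@continuousZ _ _ _ snd (fun z : 'rV[R]_k * R => z.1 - p) z).
  exact: cvg_snd.
by apply: continuousB; [exact: cvg_fst|exact: cvg_cst].
Qed.

(* Differentiating under the integral in direction i turns (j, f) into
   (j + 1, D_i f), so these integrals are closed under differentiation. *)
Lemma Cinf_int_radial k (p : 'rV[R]_k) j f : Cinf setT f ->
  Cinf setT (fun x => int01 (radial p j f x)).
Proof.
move=> Cf.
pose S := [set u | exists j f, Cinf setT f /\ u = fun x => int01 (radial p j f x)].
apply: (@Cinf_stable _ _ S); first exact: openT.
- move=> u x [{}j [{}f [{}Cf ->]]] _; apply: continuous_int01.
  by apply: continuous_radial => y; exact: Cinf_cont Cf _.
- move=> u i [{}j [{}f [{}Cf ->]]].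
  pose df := 'D_(delta_mx 0 i) f.
  exists (fun x => int01 (radial p j.+1 df x)).
    by exists j.+1, df; split=> //; exact: Cinf_derive.
  move=> x _.
  have cF s : continuous (radial p j f (s *: delta_mx 0 i + x)).
    apply: continuous_section; apply: continuous_radial => y; exact: Cinf_cont Cf _.
  have cdF : continuous (fun z : R * R =>
      radial p j.+1 df (z.1 *: delta_mx 0 i + x) z.2).
    move=> z; apply: (@continuous_comp _ _ _
      (fun z : R * R => (z.1 *: delta_mx 0 i + x, z.2))
      (fun z : 'rV[R]_k * R => radial p j.+1 df z.1 z.2)).
      apply: continuous_pair_at; last exact: cvg_snd.
      apply: continuousD; last exact: cvg_cst.
      apply: continuousZ; first exact: cvg_fst.
      exact: cvg_cst.
    apply: continuous_radial => y; exact: (Cinf_cont (Cinf_derive i Cf)).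
  have FdF (s t : R) : is_derive s 1
      (fun s => radial p j f (s *: delta_mx 0 i + x) t)
      (radial p j.+1 df (s *: delta_mx 0 i + x) t).
    have E (r : R) : t *: (r *: delta_mx 0 i + x - p) + p =
        (r * t) *: delta_mx 0 i + (t *: (x - p) + p).
      by rewrite -(addrA (r *: _)) scalerDr scalerA (mulrC t) addrA.
    rewrite /radial E.
    under eq_fun do rewrite E.
    set y := t *: (x - p) + p.
    have D1 : is_derive (s * t) 1 (fun r => f (r *: delta_mx 0 i + y))
        (df ((s * t) *: delta_mx 0 i + y)).
      by apply: is_derive_line; exact: (Cdiff_derivable i (Cf 1%N)).
    have D2 : is_derive s 1 (fun r : R => r * t) t.
      by apply: is_derive_eq; rewrite /GRing.scale/= mulr0 add0r mulr1.
    have D3 := @is_derive1_comp R (fun r => f (r *: delta_mx 0 i + y))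
      (fun r : R => r * t) s _ _ D1 D2.
    rewrite (_ : t ^+ j.+1 * _ = t ^+ j *: (df ((s * t) *: delta_mx 0 i + y) * t)).
      exact: (is_deriveZ (t ^+ j) D3).
    by rewrite exprSr -mulrA (mulrC t).
  have := is_derive_int01 0 cF cdF FdF.
  by rewrite scale0r add0r; exact: is_derive_line0.
- by exists j, f.
Qed.

(** The fundamental theorem of calculus along the segment from p to x. *)
Lemma hadamard k (p : 'rV[R]_k) f : Cinf setT f ->
  exists g : 'I_k -> 'rV[R]_k -> R, (forall i, Cinf setT (g i)) /\
    forall x, f x = f p + \sum_i (x 0 i - p 0 i) * g i x.
Proof.
move=> Cf; exists (fun i x => int01 (radial p 0 ('D_(delta_mx 0 i) f) x)).
split=> [i|x]; first exact/Cinf_int_radial/Cinf_derive.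
have cr i : continuous (radial p 0 ('D_(delta_mx 0 i) f) x).
  apply: continuous_section; apply: continuous_radial => y.
  exact: Cinf_cont (Cinf_derive i Cf) _.
transitivity (f p + int01 (fun t => \sum_i (x 0 i - p 0 i) *
    radial p 0 ('D_(delta_mx 0 i) f) x t)).
  have cs := (int01_sum (fun i => x 0 i - p 0 i) cr).1.
  have dF (t : R) : is_derive t 1 (fun t => f (t *: (x - p) + p))
      (\sum_i (x 0 i - p 0 i) * radial p 0 ('D_(delta_mx 0 i) f) x t).
    have D := @is_derive_C1 k setT f (t *: (x - p) + p) (x - p) openT I (Cf 1%N).
    have D' := @ex_derive _ _ _ _ _ _ _ D.
    have := is_derive_line D'; rewrite (@derive_val _ _ _ _ _ _ _ D).
    congr is_derive; apply: eq_bigr => i _.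
    by rewrite /radial expr0 mul1r mulrC !mxE.
  rewrite (int01_FTC cs dF).
  by rewrite scale1r scale0r subrK add0r addrC subrK.
by rewrite (int01_sum _ cr).2.
Qed.

End Hadamard.

(** * A smooth step function *)

Section Step.
Variable R : realType.

Lemma is_derive_coord1 (f : R -> R) (x : 'rV[R]_1) i d :
  is_derive (x 0 0) 1 f d ->
  is_derive x (delta_mx 0 i) (fun y : 'rV[R]_1 => f (y 0 0)) d.
Proof.
have E : (fun h : R => h^-1 *: ((f \o shift (x 0 0)) (h *: 1) - f (x 0 0))) =
    (fun h : R => h^-1 *: (((fun y : 'rV[R]_1 => f (y 0 0)) \o shift x)
      (h *: delta_mx 0 i) - f (x 0 0))).
  by apply/funext => h /=; rewrite !mxE [i]ord1.
by move=> [H1 H2]; apply: DeriveDef; move: H1 H2; rewrite /derivable/derive/= E.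
Qed.

(** The function exp(-1/t) extended by 0, with a power of 1/t in front so that the family is closed,
    up to linear combinations, under differentiation. *)
Definition flat (n : nat) (t : R) : R :=
  if 0 < t then t^-1 ^+ n * expR (- t^-1) else 0.

Lemma flat_ge0 n t : 0 <= flat n t.
Proof.
rewrite /flat; case: ifP => // t0.
by rewrite mulr_ge0 ?expR_ge0// exprn_ge0// invr_ge0 ltW.
Qed.

Lemma flat_gt0 t : 0 < t -> 0 < flat 0 t.
Proof. by move=> t0; rewrite /flat t0 expr0 mul1r expR_gt0. Qed.

(** One term of the exponential series at s = 1/t bounds exp(-s). The index n + 2 leaves the factor
    t^2, which makes the derivative at 0 vanish. *)
Lemma flat_le n t : flat n t <= n.+2`!%:R * t ^+ 2.
Proof.
rewrite /flat; case: ifP => t0; last by rewrite mulr_ge0// sqr_ge0.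
set s := t^-1; have s0 : 0 < s by rewrite invr_gt0.
rewrite expRN ler_pdivrMr ?expR_gt0//.
have F0 : 0 < n.+2`!%:R :> R by rewrite ltr0n fact_gt0.
have := expR_ge1Dxn n.+1 (ltW s0) => H.
have {H} : s ^+ n.+2 / n.+2`!%:R <= expR s by lra.
rewrite ler_pdivrMr// => H.
have t2 : 0 <= t ^+ 2 by exact: sqr_ge0.
have := ler_wpM2l t2 H.
rewrite (_ : t ^+ 2 * s ^+ n.+2 = s ^+ n).
  by move=> ?; rewrite -mulrA mulrC -mulrA.
by rewrite -(addn2 n) exprD mulrCA -exprMn mulfV ?gt_eqF// expr1n mulr1.
Qed.

Lemma is_derive_inv_exp n (t : R) : t != 0 ->
  is_derive t 1 (fun t : R => t^-1 ^+ n) (- n%:R * t^-1 ^+ n.+1).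
Proof.
move=> t0; have D : is_derive t 1 (fun t : R => t^-1) (- t ^- 2 *: 1).
  exact: is_deriveV.
rewrite (_ : - n%:R * _ = (n%:R * t^-1 ^+ n.-1) *: (- t ^- 2 *: 1)).
  by have := is_deriveX n D; rewrite exprfctE.
rewrite /GRing.scale/=; case: n => [|n]; first by rewrite !mulr0n; ring.
by rewrite -exprVn [RHS]mulrA mulr1 !exprS expr0 /=; ring.
Qed.

Lemma is_derive_flat n (t : R) :
  is_derive t 1 (flat n) (flat n.+2 t - n%:R * flat n.+1 t).
Proof.
have [t0|t0|->] := ltgtP t 0.
- have -> : flat n.+2 t - n%:R * flat n.+1 t = 0.
    by rewrite /flat ltNge (ltW t0)/= mulr0 subr0.
  apply: near_eq_is_derive (is_derive_cst (0 : R) t 1).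
  apply: (@open_near_eq _ _ [set t : R | t < 0]) => //.
  by move=> s /= s0; rewrite /flat ltNge (ltW s0).
- have tn0 : t != 0 by rewrite gt_eqF.
  have -> : flat n.+2 t - n%:R * flat n.+1 t =
      t^-1 ^+ n *: (expR (- t^-1) * - (- 1%N%:R * t^-1 ^+ 2)) +
      expR (- t^-1) *: (- n%:R * t^-1 ^+ n.+1).
    by rewrite /flat t0 /GRing.scale/= !exprS expr0; ring.
  have E : {near t, (fun t => t^-1 ^+ n * expR (- t^-1)) =1 flat n}.
    apply: (@open_near_eq _ _ [set t : R | 0 < t]) => //.
    by move=> s /= s0; rewrite /flat s0.
  have D1 := is_derive_inv_exp n tn0.
  have D2 : is_derive t 1 (fun t : R => - t^-1) (- (- 1%N%:R * t^-1 ^+ 2)).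
    have := is_deriveN (is_derive_inv_exp 1 tn0).
    by under eq_fun do rewrite expr1.
  have D3 := @is_derive1_comp R expR (fun t => - t^-1) t _ _ (is_derive_expR _) D2.
  exact: near_eq_is_derive E (is_deriveM D1 D3).
have -> : flat n.+2 0 - n%:R * flat n.+1 0 = 0 :> R.
  by rewrite /flat ltxx mulr0 subr0.
have f0 : flat n 0 = 0 by rewrite /flat ltxx.
suff H : h^-1 *: ((flat n \o shift (0 : R)) (h *: 1) - flat n 0)
    @[h --> (0 : R)^'] --> (0 : R).
  by apply: DeriveDef; [apply/cvg_ex; eexists; exact: H|exact: cvg_lim H].
rewrite f0; set C : R := n.+2`!%:R.
have C0 : 0 < C by rewrite ltr0n fact_gt0.
apply/cvgrPdist_le => e e0.
(* The quadratic bound makes the quotient at most C |h|, which is below e as soon as |h| < e / C. *)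
have eC : 0 < e / C by rewrite divr_gt0.
near=> h; rewrite sub0r normrN subr0 /= addr0 [h *: 1]mulr1 normrM.
have h0 : h != 0 by near: h; exact: nbhs_dnbhs_neq.
have hn : 0 < `|h| by rewrite normr_gt0.
rewrite normfV ler_pdivrMl// (ger0_norm (flat_ge0 _ _)).
apply: le_trans (flat_le _ _) _; rewrite -real_normK ?num_real//.
rewrite expr2 mulrCA ler_pM2l// -/C mulrC -ler_pdivlMr//.
by apply/ltW; near: h; exact: dnbhs0_lt.
Unshelve. all: end_near. Qed.

Lemma Cinf_flat n : Cinf setT (fun x : 'rV[R]_1 => flat n (x 0 0)).
Proof.
move=> j; elim: j n => [|j ih] n.
  split=> // x _; apply: (@continuous_comp _ _ _ (fun x : 'rV[R]_1 => x 0 0)).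
    exact: coord_continuous.
  apply/differentiable_continuous/derivable1_diffP.
  by have [] := is_derive_flat n (x 0 0).
have D (x : 'rV[R]_1) i := is_derive_coord1 i (is_derive_flat n (x 0 0)).
split=> [x _|i].
  apply: (@continuous_comp _ _ _ (fun x : 'rV[R]_1 => x 0 0)).
    exact: coord_continuous.
  apply/differentiable_continuous/derivable1_diffP.
  by have [] := is_derive_flat n (x 0 0).
split=> [x _|]; first by have [] := D x i.
have := CdiffD openT (ih n.+2) (CdiffM openT (Cdiff_cst j setT (- n%:R)) (ih n.+1)).
apply: eq_Cdiff; first exact: openT.
by move=> x _; have [_ ->] := D x i; rewrite mulNr.
Qed.

Lemma Cinf_inv : Cinf [set x : 'rV[R]_1 | x 0 0 != 0] (fun x => (x 0 0)^-1).
Proof.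
pose S := [set u | exists c n, u = fun x : 'rV[R]_1 => c * (x 0 0)^-1 ^+ n].
have dS c n (x : 'rV[R]_1) : x 0 0 != 0 -> 
    is_derive (x 0 0) 1 (fun t => c * t^-1 ^+ n) ((c * - n%:R) * (x 0 0)^-1 ^+ n.+1).
  move=> x0; rewrite -mulrA; exact: (is_deriveZ c (is_derive_inv_exp n x0)).
apply: (@Cinf_stable _ _ _ S).
- apply: (@open_comp _ _ (fun x : 'rV[R]_1 => x 0 0) [set t | t != 0]).
    by move=> x _; exact: coord_continuous.
  exact: open_neq.
- move=> u x [c [n ->]] /= x0.
  apply: (@continuous_comp _ _ _ (fun x : 'rV[R]_1 => x 0 0)
    (fun t => c * t^-1 ^+ n)); first exact: coord_continuous.
  apply/differentiable_continuous/derivable1_diffP.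
  by have [] := dS c n x x0.
- move=> u i [c [n ->]]; exists (fun x => (c * - n%:R) * (x 0 0)^-1 ^+ n.+1).
    by exists (c * - n%:R), n.+1.
  by move=> x x0; exact: (is_derive_coord1 i (dS c n x x0)).
- by exists 1, 1%N; apply/funext => x; rewrite mul1r expr1.
Qed.

Lemma smooth_step : exists s : R -> R,
  [/\ Cinf setT (fun x : 'rV[R]_1 => s (x 0 0)), forall t, t <= 0 -> s t = 0
    & forall t, 1 <= t -> s t = 1].
Proof.
(* This denominator is positive everywhere, since t or 1 - t is positive. *)
pose d t : R := flat 0 t + flat 0 (1 - t).
have d0 t : 0 < d t.
  rewrite /d; have [t0|t0] := ltP 0 t; first by rewrite ltr_pwDl ?flat_gt0 ?flat_ge0.
  by rewrite ltr_wpDl ?flat_ge0// flat_gt0//; lra.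
exists (fun t => flat 0 t * (d t)^-1); split; last 2 first.
- by move=> t; rewrite leNgt => /negbTE t0; rewrite /flat t0 mul0r.
- move=> t t1; rewrite /d [flat 0 (1 - t)]/flat subr_gt0 ltNge t1 addr0.
  by rewrite mulfV// gt_eqF// flat_gt0//; lra.
move=> j; apply: CdiffM; [exact: openT|exact: Cinf_flat|].
have Cd : Cdiff j setT (fun x : 'rV[R]_1 => d (x 0 0)).
  apply: CdiffD; [exact: openT|exact: Cinf_flat|].
  have C1 (i : 'I_1) : Cdiff j setT (fun x : 'rV[R]_1 => 1 - x 0 0).
    apply: CdiffD; [exact: openT|exact: Cdiff_cst|].
    have := CdiffM openT (Cdiff_cst j (setT : set 'rV[R]_1) (-1))
      (Cdiff_coord j setT (0 : 'I_1)).
    by apply: eq_Cdiff; [exact: openT|move=> x _; rewrite mulN1r].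
  have := Cdiff_comp openT openT (fun _ _ => I) (Cinf_flat 0 j) C1.
  by apply: eq_Cdiff; [exact: openT|move=> x _; rewrite mxE].
have oW : open [set x : 'rV[R]_1 | x 0 0 != 0].
  apply: (@open_comp _ _ (fun x : 'rV[R]_1 => x 0 0) [set t | t != 0]).
    by move=> x _; exact: coord_continuous.
  exact: open_neq.
have dW (x : 'rV[R]_1) : setT x ->
    [set x : 'rV[R]_1 | x 0 0 != 0] (\row_(i < 1) d (x 0 0)).
  by move=> _ /=; rewrite mxE gt_eqF.
have := Cdiff_comp oW openT dW (Cinf_inv j) (fun=> Cd).
by apply: eq_Cdiff; [exact: openT|move=> x _; rewrite mxE].
Qed.

End Step.

(** * Differential spaces *)

Section Dstruct.
Variable R : realType.

Lemma CinfM k (W : set 'rV[R]_k) u v : open W -> Cinf W u -> Cinf W v ->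
  Cinf W (fun x => u x * v x).
Proof. by move=> oW Cu Cv j; exact: CdiffM. Qed.

Lemma Cinf_comp k n (W : set 'rV[R]_k) (V : set 'rV[R]_n)
    (u : 'rV[R]_k -> R) (f : 'I_k -> 'rV[R]_n -> R) :
  open W -> open V -> (forall x, V x -> W (\row_i f i x)) ->
  Cinf W u -> (forall i, Cinf V (f i)) -> Cinf V (fun x => u (\row_i f i x)).
Proof. by move=> oW oV fVW Cu Cf j; apply: (Cdiff_comp oW) => // i; exact: Cf. Qed.

Lemma Cinf_bigcup k (W : set 'rV[R]_k) u :
  (forall x, W x -> exists V, V x /\ Cinf V u) -> Cinf W u.
Proof.
by move=> Wu j; apply: Cdiff_bigcup => x /Wu[V [Vx Cu]]; exists V.
Qed.

Lemma eq_Cinf k (W : set 'rV[R]_k) u v : open W ->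
  (forall x, W x -> u x = v x) -> Cinf W u -> Cinf W v.
Proof. by move=> oW uv Cu j; exact: eq_Cdiff (Cu j). Qed.

(** * Closure properties of a differential structure and bump functions *)

Section Closure.
Variables (T : Type) (C : set (T -> R)) (dC : is_dstruct C).

Lemma sm_comp m (u : 'rV[R]_m -> R) (f : 'I_m -> T -> R) :
  Cinf setT u -> (forall i, C (f i)) -> C (fun x => u (\row_i f i x)).
Proof. by move=> Cu Cf; exact: dC.2. Qed.

(** Constants are smooth functions of zero arguments. *)
Lemma sm_cst c : C (fun=> c).
Proof.
have := @sm_comp 0 (fun=> c) (fun i _ => c); apply; last by case.
by move=> j; exact: Cdiff_cst.
Qed.

Lemma sm_comp1 (u : R -> R) f :
  Cinf setT (fun x : 'rV[R]_1 => u (x 0 0)) -> C f -> C (fun x => u (f x)).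
Proof.
move=> Cu Cf; have := @sm_comp 1 _ (fun=> f) Cu (fun=> Cf).
by under eq_fun do rewrite mxE.
Qed.

Lemma sm_comp2 (u : R -> R -> R) f g :
  Cinf setT (fun x : 'rV[R]_2 => u (x 0 0) (x 0 1)) -> C f -> C g ->
  C (fun x => u (f x) (g x)).
Proof.
move=> Cu Cf Cg; have H : C (fun x => (fun y : 'rV[R]_2 => u (y 0 0) (y 0 1))
    (\row_(i < 2) (if i == 0 then f else g) x)).
  apply: (sm_comp (f := fun i : 'I_2 => if i == 0 then f else g) Cu) => i.
  by case: ifP.
by move: H; under eq_fun do rewrite !mxE/=.
Qed.

Lemma smD f g : C f -> C g -> C (fun x => f x + g x).
Proof.
apply: sm_comp2 => j; apply: CdiffD; [exact: openT|exact: Cdiff_coord..].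
Qed.

Lemma smM f g : C f -> C g -> C (fun x => f x * g x).
Proof.
apply: sm_comp2 => j; apply: CdiffM; [exact: openT|exact: Cdiff_coord..].
Qed.

Lemma smZ c f : C f -> C (fun x => c * f x).
Proof. exact: smM (sm_cst c). Qed.

Lemma smN f : C f -> C (fun x => - f x).
Proof. by move=> /(smZ (-1)); under eq_fun do rewrite mulN1r. Qed.

Lemma smB f g : C f -> C g -> C (fun x => f x - g x).
Proof. by move=> Cf /smN; exact: smD. Qed.

Lemma sm_sum (I : Type) (r : seq I) (P : pred I) (f : I -> T -> R) :
  (forall i, C (f i)) -> C (fun x => \sum_(i <- r | P i) f i x).
Proof.
move=> Cf; elim: r => [|i r ih].
  by under eq_fun do rewrite big_nil; exact: sm_cst.
under eq_fun do rewrite big_cons.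
by case: (P i) => //; exact: smD.
Qed.

Lemma iopenI (U V : set T) : iopen C U -> iopen C V -> iopen C (U `&` V).
Proof.
move=> oU oV p [/oU[m [f [e [Cf e0 fV]]]] /oV[n [g [d [Cg d0 gV]]]]].
pose k (i : 'I_(m + n)) :=
  match fintype.split i with inl i => f i | inr i => g i end.
exists (m + n)%N, k, (Num.min e d); rewrite /k; split.
- by move=> i; case: fintype.split.
- by rewrite lt_min e0.
move=> x fg; split; [apply: fV => i|apply: gV => i].
  by have := fg (unsplit (inl i)); rewrite unsplitK lt_min => /andP[].
by have := fg (unsplit (inr i)); rewrite unsplitK lt_min => /andP[].
Qed.

Lemma iopen_preimage m (f : 'I_m -> T -> R) (W : set 'rV[R]_m) :
  (forall i, C (f i)) -> open W -> iopen C [set x | W (\row_i f i x)].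
Proof.
move=> Cf oW p /= Wp; have /nbhs_ballP[e /= e0 eW] := open_nbhs_nbhs (conj oW Wp).
exists m, f, e; split=> // x fx; apply: eW; split=> // i j.
by rewrite !mxE /ball/= distrC.
Qed.

Lemma iopen_lt f c : C f -> iopen C [set x | f x < c].
Proof.
move=> Cf p /= fp; exists 1%N, (fun=> f), (c - f p); split=> //.
  by rewrite subr_gt0.
by move=> x /(_ 0) /ltr_normlW /=; lra.
Qed.

Lemma iopen_gt f c : C f -> iopen C [set x | c < f x].
Proof.
move=> /smN/(@iopen_lt _ (- c)).
by rewrite (_ : [set x | _] = [set x | c < f x])//; apply/seteqP; split=> x /=;
  rewrite ltrN2.
Qed.

(** A basic neighbourhood inside U is given by finitely many smooth functions, so rho can be a step
    function of the sum of squares of their normalized increments. Instead of a support, the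
    statement gives an open set U' on which rho vanishes and which covers the space together with U;
    this is the form needed for gluing. *)
Lemma cutoff (U : set T) p : iopen C U -> U p ->
  exists rho V U', [/\ C rho, iopen C V, V p & V `<=` U] /\
    [/\ forall x, V x -> rho x = 1, iopen C U',
      forall x, U' x -> rho x = 0 & forall x, U x \/ U' x].
Proof.
move=> oU Up; have [m [f [e [Cf e0 fU]]]] := oU p Up.
pose s x := e^-2 * \sum_i (f i x - f i p) ^+ 2.
have Cs : C s.
  apply/smZ/sm_sum => i; under eq_fun do rewrite expr2.
  by apply: smM; apply: smB => //; exact: sm_cst.
have sU x : s x < 1 -> U x.
  move=> sx; apply: fU => i.
  have : (f i x - f i p) ^+ 2 < e ^+ 2.
    move: sx; rewrite /s mulrC ltr_pdivrMr ?exprn_gt0// mul1r.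
    apply: le_lt_trans; rewrite (bigD1 i)//= lerDl sumr_ge0// => j _.
    exact: sqr_ge0.
  by rewrite -ltr_sqrt ?exprn_gt0// !sqrtr_sqr (gtr0_norm e0).
have [step [Cst st0 st1]] := smooth_step R.
pose U' := [set x | 2 < 3 * s x].
pose V := [set x | 3 * s x < 1].
have C3 : C (fun x => 3 * s x) by exact: smZ.
(* The value is 1 for s < 1/3 and 0 for s > 2/3; outside U one has s >= 1, hence U' holds there. *)
exists (fun x => step (2 - 3 * s x)), V, U'; split; split.
- by apply: sm_comp1 => //; apply: smB => //; exact: sm_cst.
- exact: iopen_lt.
- rewrite /V/= /s big1 ?mulr0// => i _; by rewrite subrr expr0n.
- by move=> x; rewrite /V /= => sx; apply: sU; lra.
- by move=> x; rewrite /V /= => sx; apply: st1; lra.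
- exact: iopen_gt.
- by move=> x; rewrite /U'/= => sx; apply: st0; lra.
- by move=> x; have [sx|sx] := ltP (s x) 1; [left; exact: sU|right; rewrite /U'/=; lra].
Qed.

(** Gluing over the open cover by U and U': near a point of U the function is rho times a smooth
    function, and on U' it is 0. *)
Lemma sm_cutoff U U' rho f : iopen C U -> iopen C U' -> C rho ->
  (forall x, U' x -> rho x = 0) -> (forall x, U x \/ U' x) ->
  locally_in C U f -> C (fun x => if `[< U x >] then rho x * f x else 0).
Proof.
move=> oU oU' Crho rho0 UU' lf; apply: dC.1 => p _.
have [Up|U'p] := UU' p.
  have [g [V [Cg oV Vp fg]]] := lf p Up.
  exists (fun x => rho x * g x), (U `&` V); split=> //; first exact: smM.
    exact: iopenI.
  by move=> x [Ux Vx]; rewrite asboolT// fg.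
exists (fun=> 0), U'; split=> //; first exact: sm_cst.
by move=> x U'x; case: ifP => // _; rewrite rho0// mul0r.
Qed.

End Closure.

(** * Row vectors as a differential space *)

Lemma nbhs_forall (T : topologicalType) (I : finType) (p : T) (B V : set T)
    (A : I -> set T) : nbhs p B -> (forall i, nbhs p (A i)) ->
  (forall y, B y -> (forall i, A i y) -> V y) -> nbhs p V.
Proof.
move=> pB pA ABV.
have pA' : nbhs p [set y | forall i, A i y] by exact: filter_forall.
apply: (@filterS _ (nbhs p) (nbhs_filter p) (B `&` [set y | forall i, A i y])).
  by move=> y [By Ay]; exact: ABV.
exact: filterI.
Qed.

Lemma iopen_rV k (U : set 'rV[R]_k) : iopen (Cinf setT) U -> open U.
Proof.
move=> oU; rewrite openE => p /oU[m [f [e [Cf e0 fU]]]].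
have H i : nbhs p [set x | `|f i x - f i p| < e].
  have /cvgrPdist_lt/(_ _ e0) := Cinf_cont (Cf i) (I : setT p).
  by apply: filterS => x; rewrite /= distrC.
suff: nbhs p U by [].
by apply: (nbhs_forall filterT H) => y _; exact: fU.
Qed.

Lemma open_iopen k (U : set 'rV[R]_k) : open U -> iopen (Cinf setT) U.
Proof.
move=> oU p Up; have /nbhs_ballP[e /= e0 eW] := open_nbhs_nbhs (conj oU Up).
exists k, (fun i x => x 0 i), e; split=> //.
  by move=> i j; exact: Cdiff_coord.
move=> x fx; apply: eW; split=> // i j; rewrite ord1.
by rewrite /ball/= distrC.
Qed.

Lemma Cinf_dstruct k : is_dstruct (Cinf (setT : set 'rV[R]_k)).
Proof.
split=> [f lf|m f u Cf Cu]; last first.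
  by apply: (Cinf_comp openT) => //; exact: openT.
apply: Cinf_bigcup => x _; have [g [V [Cg oV Vx fg]]] := lf x I.
exists V; split=> //; apply: (@eq_Cinf _ _ g).
- exact: iopen_rV.
- by move=> y /fg.
- by move=> j; apply: Cdiff_subset (Cg j).
Qed.

(** A differential structure is only closed under composition with functions smooth on the whole of
    R^k. This lemma makes functions smooth on an open subset usable, such as 1/x or local
    expressions in a chart. *)
Lemma Cinf_locally k (W : set 'rV[R]_k) u : open W -> Cinf W u ->
  locally_in (Cinf setT) W u.
Proof.
move=> oW Cu p Wp.
have [rho [V [U' [[Crho oV Vp VW] [rho1 oU' rho0 UU']]]]] :=
  cutoff (Cinf_dstruct k) (open_iopen oW) Wp.
exists (fun x => if `[< W x >] then rho x * u x else 0), V; split=> //.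
  apply: Cinf_bigcup => x _; have [Wx|U'x] := UU' x.
    exists W; split=> //; apply: (@eq_Cinf _ _ (fun x => rho x * u x)) => //.
      by move=> y Wy; rewrite asboolT.
    by apply: CinfM => // j; apply: Cdiff_subset (Crho j).
  exists U'; split=> //; apply: (@eq_Cinf _ _ (fun=> 0)) => //.
  - exact: iopen_rV.
  - by move=> y U'y; case: ifP => // _; rewrite rho0// mul0r.
  - by move=> j; exact: Cdiff_cst.
by move=> x Vx; rewrite asboolT ?rho1 ?mul1r//; exact: VW.
Qed.

Lemma sm_comp_locally T (C : set (T -> R)) m (W : set 'rV[R]_m) U
    (u : 'rV[R]_m -> R) (f : 'I_m -> T -> R) : is_dstruct C ->
  open W -> (forall x, U x -> W (\row_i f i x)) ->
  Cinf W u -> (forall i, C (f i)) -> locally_in C U (fun x => u (\row_i f i x)).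
Proof.
move=> dC oW fW Cu Cf p Up.
have [v [V [Cv oV Vp uv]]] := Cinf_locally oW Cu (fW p Up).
exists (fun x => v (\row_i f i x)), [set x | V (\row_i f i x)]; split=> //.
- exact: (sm_comp dC Cv Cf).
- by apply: iopen_preimage => //; exact: iopen_rV.
- by move=> x /= /uv.
Qed.

Lemma sm_inv T (C : set (T -> R)) U f : is_dstruct C -> C f ->
  (forall x, U x -> f x != 0) -> locally_in C U (fun x => (f x)^-1).
Proof.
move=> dC Cf f0.
have oW : open [set x : 'rV[R]_1 | x 0 0 != 0].
  apply: (@open_comp _ _ (fun x : 'rV[R]_1 => x 0 0) [set t | t != 0]).
    by move=> x _; exact: coord_continuous.
  exact: open_neq.
have fW x : U x -> [set x : 'rV[R]_1 | x 0 0 != 0] (\row_(i < 1) f x).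
  by move=> Ux /=; rewrite mxE f0.
have := sm_comp_locally dC oW fW (@Cinf_inv R) (fun=> Cf).
by under eq_fun do rewrite mxE.
Qed.

End Dstruct.

(** * Tangent vectors *)

Section Tan.
Variable R : realType.
Implicit Types M N P : dspace R.

Lemma derivation_tan M (p : M) (v : Tan p) : derivation p v.
Proof. by have /asboolP := tan_funP v. Qed.

Definition mktan M (p : M) (v : (M -> R) -> R) (dv : derivation p v) : Tan p :=
  MkTan (introT (asboolP _) dv : v \in tangent p).

Lemma tan_ext M (p : M) (v w : Tan p) : (forall f, sm f -> v f = w f) -> v = w.
Proof.
move=> vw; apply: val_inj; apply/funext => f /=.
have [/vw//|nf] := pselect (sm f).
by have [_ _ ->//] := derivation_tan v; have [_ _ ->//] := derivation_tan w.
Qed.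

Section Ops.
Variables (M : dspace R) (p : M) (v w : Tan p).

Lemma tan_linear a f g : sm f -> sm g ->
  v (fun x => a * f x + g x) = a * v f + v g.
Proof. by have [vl _ _] := derivation_tan v; exact: vl. Qed.

Lemma tanM f g : sm f -> sm g -> v (fun x => f x * g x) = f p * v g + g p * v f.
Proof. by have [_ vm _] := derivation_tan v; exact: vm. Qed.

Lemma tan_cst c : v (fun=> c) = 0.
Proof.
have s1 := sm_cst (smP M) 1; have sc := sm_cst (smP M) c.
have v1 : v (fun=> 1) = 0.
  have := tanM s1 s1; under [X in v X]eq_fun do rewrite mulr1.
  lra.
have := tan_linear c s1 (sm_cst (smP M) 0); rewrite v1 mulr0 add0r.
under [X in v X]eq_fun do rewrite mulr1 addr0.
have := tan_linear (- 1) (sm_cst (smP M) 0) (sm_cst (smP M) 0).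
under [X in v X]eq_fun do rewrite mulr0 addr0.
by lra.
Qed.

Lemma tanD f g : sm f -> sm g -> v (fun x => f x + g x) = v f + v g.
Proof.
move=> sf sg; have := tan_linear 1 sf sg; rewrite mul1r => <-.
by under [in RHS]eq_fun do rewrite mul1r.
Qed.

Lemma tanZ a f : sm f -> v (fun x => a * f x) = a * v f.
Proof.
move=> sf; have := tan_linear a sf (sm_cst (smP M) 0); rewrite tan_cst addr0 => <-.
by under [in RHS]eq_fun do rewrite addr0.
Qed.

Lemma tanN f : sm f -> v (fun x => - f x) = - v f.
Proof.
by move=> sf; rewrite -mulN1r -tanZ//; under [in RHS]eq_fun do rewrite mulN1r.
Qed.

Lemma tanB f g : sm f -> sm g -> v (fun x => f x - g x) = v f - v g.
Proof. by move=> sf sg; rewrite (tanD sf (smN (smP M) sg)) tanN. Qed.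

Lemma tan_sum (I : Type) (r : seq I) (P : pred I) (f : I -> M -> R) :
  (forall i, sm (f i)) ->
  v (fun x => \sum_(i <- r | P i) f i x) = \sum_(i <- r | P i) v (f i).
Proof.
move=> sf; elim: r => [|i r ih].
  by under eq_fun do rewrite big_nil; rewrite big_nil tan_cst.
under eq_fun do rewrite big_cons; rewrite big_cons; case: (P i) => //.
by rewrite tanD ?ih//; exact: (sm_sum (smP M)).
Qed.

(** A bump function rho at p annihilates f - g everywhere; the Leibniz rule at p, where rho is 1 and
    f - g is 0, leaves v(f - g) = 0. *)
Lemma tan_local (V : set M) f g : dopen V -> V p -> sm f -> sm g ->
  (forall x, V x -> f x = g x) -> v f = v g.
Proof.
move=> oV Vp sf sg fg.
have [rho [V1 [U' [[srho oV1 V1p V1V] [rho1 oU' rho0 UU']]]]] :=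
  cutoff (smP M) oV Vp.
have sd := smB (smP M) sf sg.
have : v (fun x => rho x * (f x - g x)) = 0.
  rewrite (_ : (fun x => _) = fun=> 0) ?tan_cst//; apply/funext => x.
  by have [/fg ->|/rho0 ->] := UU' x; rewrite ?subrr ?mulr0// mul0r.
by rewrite tanM// rho1// mul1r fg// subrr mul0r addr0 tanB//; lra.
Qed.

(* Hadamard's lemma expresses u near f(p) as u(f(p)) plus the sum of
   (x_i - f_i(p)) g_i(x), to which the Leibniz rule applies. *)
Lemma tan_chain m (u : 'rV[R]_m -> R) (f : 'I_m -> M -> R) :
  Cinf setT u -> (forall i, sm (f i)) ->
  v (fun x => u (\row_i f i x)) =
  \sum_i 'D_(delta_mx 0 i) u (\row_i f i p) * v (f i).
Proof.
move=> Cu sf; set q := \row_i f i p.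
have [g [Cg ug]] := hadamard q Cu.
have sg i : sm (fun x => g i (\row_i f i x)) by exact: (sm_comp (smP M) (Cg i) sf).
have sB i : sm (fun x => f i x - f i p).
  by apply: smB => //; [exact: smP|apply: sm_cst; exact: smP].
have -> : (fun x => u (\row_i f i x)) =
    fun x => u q + \sum_i (f i x - f i p) * g i (\row_i f i x).
  apply/funext => x; rewrite ug; congr (_ + _); apply: eq_bigr => i _.
  by rewrite !mxE.
have sP i : sm (fun x => (f i x - f i p) * g i (\row_i f i x)).
  by apply: smM => //; exact: smP.
rewrite tanD; [|apply: sm_cst; exact: smP|by apply: sm_sum => //; exact: smP].
rewrite tan_cst add0r tan_sum//; apply: eq_bigr => i _.
rewrite tanM// subrr mul0r add0r tanB ?tan_cst ?subr0//; last first.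
  by apply: sm_cst; exact: smP.
congr (_ * _).
have D j : is_derive q (delta_mx 0 i) (fun x : 'rV[R]_m => (x 0 j - q 0 j) * g j x)
    ((j == i)%:R * g j q).
  have D1 : is_derive q (delta_mx 0 i) (fun x : 'rV[R]_m => x 0 j - q 0 j) (j == i)%:R.
    have := is_deriveB (is_derive_coord j q (delta_mx 0 i))
      (is_derive_cst (q 0 j) q (delta_mx 0 i)).
    by rewrite subr0 (_ : delta_mx 0 i 0 j = (j == i)%:R)// mxE eqxx.
  have D2 : is_derive q (delta_mx 0 i) (g j) ('D_(delta_mx 0 i) (g j) q).
    by apply: derivableP; exact: (Cdiff_derivable i (Cg j 1%N)).
  have [H1 H2] := is_deriveM D1 D2.
  apply: DeriveDef; first exact: H1.
  by rewrite H2 subrr /GRing.scale/=; ring.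
have := is_deriveD (is_derive_cst (u q) q (delta_mx 0 i)) (is_derive_sum D).
rewrite add0r fct_sumE (_ : _ + _ = u) => [[_ ->]|].
  rewrite (bigD1 i)//= eqxx mul1r big1 ?addr0// => j /negbTE ->.
  by rewrite mul0r.
by apply/funext => x; rewrite /= fctE [RHS]ug.
Qed.

End Ops.

(** The smooth functions on which v and w agree form a differential structure: locality is
    [tan_local] and closure under composition is [tan_chain]. It contains the generators, hence
    everything. *)
Lemma tan_gen T (G : set (T -> R)) (p : gen_space G) (v w : Tan p) :
  (forall f, G f -> v f = w f) -> v = w.
Proof.
move=> vw; apply: tan_ext => f /(_ [set f | @sm _ (gen_space G) f /\ v f = w f]).
have GG : G `<=` @sm _ (gen_space G) by move=> g Gg C _; exact.
case=> [||//]; last by move=> g Gg; split; [exact: GG|exact: vw].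
split=> [g lg|m g u vwg Cu].
  have sg : sm (d := gen_space G) g.
    apply: (smP (gen_space G)).1 => q Vq.
    have [k [V [[sk _] oV Vq' gk]]] := lg q I.
    exists k, V; split=> //= x /oV [m [a [e [sa e0 aV]]]].
    by exists m, a, e; split=> // i; have [] := sa i.
  split=> //; have [k [V [[sk vwk] oV Vq' gk]]] := lg p I.
  (* A set open for the smaller family of functions is open for the full structure. *)
  have oV' : @dopen _ (gen_space G) V.
    move=> x /oV [m [a [e [sa e0 aV]]]].
    by exists m, a, e; split=> // i; have [] := sa i.
  by rewrite (tan_local _ oV' Vq' sg sk gk) vwk; apply/esym; apply: (tan_local _ oV').
have sg i : sm (d := gen_space G) (g i) by have [] := vwg i.
split; first exact: (sm_comp (smP _) Cu).
by rewrite !tan_chain//; apply: eq_bigr => i _; have [_ ->] := vwg i.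
Qed.

(** The default 0 of [dmap] is excluded because the formula is a derivation at q, whose Leibniz rule
    uses f p = q. Keeping this equation as a hypothesis lets the target point be only
    propositionally equal to f p. *)
Lemma dmapE M N (f : M -> N) (p : M) (q : N) (v : Tan p) g :
  smooth f -> f p = q -> sm g -> dmap f q v g = v (g \o f).
Proof.
move=> sf fpq sg; rewrite /dmap insubdK /=; first by rewrite asboolT.
apply/asboolP; split.
- move=> a f1 f2 sf1 sf2; rewrite !asboolT//; last first.
    by apply: smD; [exact: smP|apply: smZ => //; exact: smP|].
  by rewrite -(tan_linear v)//; exact: sf.
- move=> f1 f2 sf1 sf2; rewrite !asboolT//; last by apply: smM => //; exact: smP.
  by rewrite -fpq -(tanM v)//; exact: sf.
- by move=> f1 nf1; rewrite asboolF.
Qed.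

Lemma dmap_comp M N P (f : M -> N) (g : N -> P) (p : M) (q : N) (r : P) (v : Tan p) :
  smooth f -> smooth g -> f p = q -> g q = r ->
  dmap g r (dmap f q v) = dmap (g \o f) r v.
Proof.
move=> sf sg fq gr; apply: tan_ext => k sk.
have gfr : (g \o f) p = r by rewrite /= fq.
have sgf : smooth (g \o f) by move=> l /sg /sf.
by rewrite (dmapE _ sg gr sk) (dmapE _ sf fq (sg _ sk)) (dmapE _ sgf gfr sk).
Qed.

Lemma eq_dmap M N (f g : M -> N) (p : M) (q : N) (v : Tan p) :
  f =1 g -> dmap f q v = dmap g q v.
Proof. by move=> /funext ->. Qed.

Lemma smooth_comp M N P (f : M -> N) (g : N -> P) :
  smooth f -> smooth g -> smooth (g \o f).
Proof. by move=> sf sg k /sg /sf. Qed.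

(** The functions whose composite with f is smooth form a differential structure, so generators
    suffice. *)
Lemma smooth_gen M T (G : set (T -> R)) (f : M -> gen_space G) :
  (forall g, G g -> sm (g \o f)) -> smooth f.
Proof.
move=> Gf g /(_ [set k : T -> R | sm (d := M) (k \o f)]); apply=> //; split.
  move=> k lk; apply: (smP M).1 => p _.
  have [l [V [sl oV Vp kl]]] := lk (f p) I.
  exists (l \o f), (f @^-1` V); split=> //; last by move=> x /kl.
  move=> x /oV [m [a [e [sa e0 aV]]]].
  by exists m, (fun i => a i \o f), e; split=> // y; exact: aV.
move=> m k u sk Cu; exact: (sm_comp (smP M) Cu sk).
Qed.

Lemma sm_gen T (G : set (T -> R)) g : G g -> sm (d := gen_space G) g.
Proof. by move=> Gg C _; exact. Qed.

Lemma linearizeE (V : lmodType R) (f : V -> R) :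
  (forall (a : R) u v, f (a *: u + v) = a * f u + f v) -> linearize f = f :> (V -> R).
Proof. by move=> lf; rewrite /linearize insubdK//; apply/asboolP. Qed.

Lemma ldual_linear (V : lmodType R) (b : ldual V) (a : R) u v :
  b (a *: u + v) = a * b u + b v.
Proof. by have /asboolP := ldual_funP b; exact. Qed.

Lemma tan_linearE M (p : M) (a : R) (u v : Tan p) f : (a *: u + v) f = a * u f + v f.
Proof. by []. Qed.

Lemma dmap_linear M N (f : M -> N) (p : M) (q : N) (a : R) (u v : Tan p) :
  smooth f -> f p = q -> dmap f q (a *: u + v) = a *: dmap f q u + dmap f q v.
Proof.
move=> sf fq; apply: tan_ext => g sg.
by rewrite tan_linearE !dmapE// tan_linearE.
Qed.

End Tan.

(** * Local coordinates and frames *)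

Section LocalCharts.
Variable R : realType.
Implicit Types M N : dspace R.

Lemma open_pull T (C : set (T -> R)) k (W : set 'rV[R]_k) (g : 'rV[R]_k -> T) V :
  open W -> (forall F, C F -> Cinf W (F \o g)) -> iopen C V ->
  open [set xi | W xi /\ V (g xi)].
Proof.
move=> oW Cg oV; rewrite openE => xi [Wxi /oV[m [f [e [Cf e0 fV]]]]].
have H i : nbhs xi [set y | `|f i (g y) - f i (g xi)| < e].
  have /cvgrPdist_lt/(_ _ e0) := Cinf_cont (Cg _ (Cf i)) Wxi.
  by apply: filterS => x; rewrite /= distrC.
suff : nbhs xi [set y | W y /\ V (g y)] by [].
by apply: (nbhs_forall (open_nbhs_nbhs (conj oW Wxi)) H) => y Wy /fV.
Qed.

Lemma dopen_preimage M N (f : M -> N) V : smooth f -> dopen V -> dopen (f @^-1` V).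
Proof.
move=> sf oV x /oV [m [a [e [sa e0 aV]]]].
exists m, (fun i => a i \o f), e; split=> // [i|y]; first exact: sf.
exact: aV.
Qed.

(* The functions z are defined on all of M, and g is a smooth inverse of the
   coordinate map on the open set W of R^k. *)
Definition lchart M k (U : set M) (W : set 'rV[R]_k) (z : 'I_k -> M -> R)
    (g : 'rV[R]_k -> M) : Prop :=
  [/\ dopen U /\ open W, forall i, sm (z i),
      forall q, U q -> W (\row_i z i q) /\ g (\row_i z i q) = q,
      forall xi, W xi -> U (g xi) /\ \row_i z i (g xi) = xi
    & forall F, sm F -> Cinf W (F \o g)].

Lemma lchart_restrict M k U W z g V : @lchart M k U W z g -> dopen V -> V `<=` U ->
  lchart V [set xi | W xi /\ V (g xi)] z g.
Proof.
move=> [[oU oW] sz Uz Wg Cg] oV VU; split=> //.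
- by split=> //; exact: open_pull Cg oV.
- by move=> q Vq; have [Wz gz] := Uz q (VU _ Vq); rewrite /= gz.
- by move=> xi [Wxi Vg]; have [_ zg] := Wg _ Wxi.
- by move=> F /Cg CF j; apply: Cdiff_subset (CF j) => xi [].
Qed.

(** A bump function turns the coordinates, controlled only on U, into global smooth functions
    without changing them on the smaller V. *)
Lemma chart_lchart M k (U : set M) (x : M -> 'rV[R]_k) p : chart U x -> U p ->
  exists V W z g, @lchart M k V W z g /\ V p.
Proof.
move=> [oU xinj oxU xC] Up.
have [rho [V [U' [[srho oV Vp VU] [rho1 oU' rho0 UU']]]]] := cutoff (smP M) oU Up.
have inv xi : exists q, (x @` U) xi -> U q /\ x q = xi.
  by have [[q Uq qxi]|] := pselect ((x @` U) xi); [exists q|exists p].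
have [g xg] := choice inv.
have gx q : U q -> g (x q) = q.
  move=> Uq; have [Ug xgq] : U (g (x q)) /\ x (g (x q)) = x q.
    by apply: xg; exists q.
  by apply: xinj => //; rewrite inE.
have Cg F : sm F -> Cinf (x @` U) (F \o g).
  move=> sF; apply/xC => q Uq; exists F, U; split=> // r Ur /=.
  by rewrite gx.
pose z i q := if `[< U q >] then rho q * x q 0 i else 0.
have zx q : V q -> \row_i z i q = x q.
  move=> Vq; apply/rowP => i; rewrite mxE /z asboolT; last exact: VU.
  by rewrite rho1// mul1r.
have sz i : sm (z i).
  apply: (sm_cutoff (smP M) oU oU' srho rho0 UU').
  have /xC := fun j => Cdiff_coord j (x @` U) i; exact.
exists V, [set xi | (x @` U) xi /\ V (g xi)], z, g; split=> //; split=> //.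
- by split=> //; exact: open_pull Cg oV.
- move=> q Vq; rewrite /= zx// gx; last exact: VU.
  by split=> //; split=> //; exists q => //; exact: VU.
- by move=> xi [Wxi Vg]; rewrite zx//; split=> //; have [] := xg _ Wxi.
- by move=> F /Cg CF j; apply: Cdiff_subset (CF j) => xi [].
Qed.

(** Over V the D i are the coordinate fields dual to the differentials of the z i. They are globally
    smooth, so that they can extend tangent vectors. *)
Definition frame M k (V : set M) (z : 'I_k -> M -> R) (D : 'I_k -> vfield M) : Prop :=
  [/\ dopen V, forall i, sm (z i), forall i, smooth_vfield (D i),
      forall q, V q -> forall (v : Tan q), v = \sum_i v (z i) *: D i q
    & forall q, V q -> forall i j, D i q (z j) = (j == i)%:R].

Lemma tan_sumE M (p : M) (I : Type) (r : seq I) (c : I -> R) (v : I -> Tan p) f :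
  (\sum_(i <- r) c i *: v i) f = \sum_(i <- r) c i * v i f.
Proof. by elim: r => [|i r ih]; rewrite ?big_nil// !big_cons -ih. Qed.

Lemma ldual_sum (V : lmodType R) (b : ldual V) (I : Type) (r : seq I) (c : I -> R) v :
  b (\sum_(i <- r) c i *: v i) = \sum_(i <- r) c i * b (v i).
Proof.
elim: r => [|i r ih]; last by rewrite !big_cons ldual_linear ih.
by rewrite !big_nil; have := ldual_linear b (-1) 0 0; rewrite scaler0 addr0; lra.
Qed.

(** D i is the partial derivative in the chart times a bump function. *)
Lemma lchart_frame M k U W z g p : @lchart M k U W z g -> U p ->
  exists V D, [/\ frame V z D, V p & V `<=` U].
Proof.
move=> [[oU oW] sz Uz Wg Cg] Up.
have [rho [V [U' [[srho oV Vp VU] [rho1 oU' rho0 UU']]]]] := cutoff (smP M) oU Up.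
pose e i : 'rV[R]_k := delta_mx 0 i.
(* The value 0 for nonsmooth F and outside U makes this a derivation at every point, as a vector
   field requires. *)
pose d i q F := if `[< sm F /\ U q >]
  then rho q * 'D_(e i) (F \o g) (\row_i z i q) else 0.
have dF i q F : U q -> sm F -> derivable (F \o g) (\row_i z i q) (e i).
  move=> Uq /Cg CF; apply: (Cdiff_derivable i (CF 1%N)); by have [] := Uz q Uq.
have dd i q : derivation q (d i q).
  rewrite /d; have [Uq|nUq] := pselect (U q); last first.
    have E F : `[< sm F /\ U q >] = false by apply/asboolF => -[].
    split=> [a F G _ _|F G _ _|F _]; rewrite !E; by rewrite ?mulr0 ?addr0.
  have [_ gz] := Uz q Uq.
  have E F : sm F -> `[< sm F /\ U q >] by move=> sF; apply/asboolP.
  split=> [a F G sF sG|F G sF sG|F nF]; last by rewrite asboolF// => -[].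
    have sH : sm (fun x => a * F x + G x).
      by apply: smD; [exact: smP|apply: smZ => //; exact: smP|].
    rewrite !E//.
    have -> : (fun x => a * F x + G x) \o g = a \*: (F \o g) + (G \o g) by [].
    rewrite deriveD; [|by apply: derivableZ; exact: dF|exact: dF].
    by rewrite deriveZ; [rewrite /GRing.scale/=; ring|exact: dF].
  have sH : sm (fun x => F x * G x) by apply: smM => //; exact: smP.
  rewrite !E//.
  have -> : (fun x => F x * G x) \o g = (F \o g) * (G \o g) by [].
  rewrite deriveM; [|exact: dF|exact: dF].
  by rewrite /= gz /GRing.scale/=; ring.
pose D i : vfield M := fun q => mktan (dd i q).
have DE i q F : V q -> sm F -> D i q F = 'D_(e i) (F \o g) (\row_i z i q).
  move=> Vq sF; rewrite /D/= /d asboolT; last by split=> //; exact: VU.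
  by rewrite rho1// mul1r.
exists V, D; split=> //; split=> //.
- move=> i F sF; rewrite (_ : (fun _ => _) = fun q => if `[< U q >] then
     rho q * 'D_(e i) (F \o g) (\row_i z i q) else 0).
    apply: (sm_cutoff (smP M) oU oU' srho rho0 UU').
    apply: (sm_comp_locally (smP M) oW _ (Cinf_derive i (Cg F sF)) sz) => q Uq.
    by have [] := Uz q Uq.
  apply/funext => q; rewrite /D /= /d; congr (if _ then _ else _).
  by apply/asboolP/asboolP => [[]|].
- move=> q Vq v; apply: tan_ext => F sF; rewrite tan_sumE.
  have [Wz gz] := Uz q (VU _ Vq).
  (* Near q the function F is a globally smooth function u of the coordinates, on which [tan_chain]
     evaluates any tangent vector. *)
  have [u [V1 [Cu oV1 V1z uF]]] := Cinf_locally oW (Cg F sF) Wz.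
  have oV2 := iopen_preimage sz (iopen_rV oV1).
  have sU : sm (fun x => u (\row_i z i x)) by exact: (sm_comp (smP M) Cu sz).
  rewrite (@tan_local _ M q v (U `&` [set x | V1 (\row_i z i x)]) F _ _ _
    sF sU); first last.
  + by move=> x [Ux V1x]; rewrite -uF//= ; have [_ ->] := Uz x Ux.
  + by split=> //; exact: VU.
  + exact: iopenI.
  rewrite tan_chain//; apply: eq_bigr => i _; rewrite DE// mulrC; congr (_ * _).
  apply: near_eq_derive; apply: (open_near_eq (iopen_rV oV1)) V1z => y V1y.
  by rewrite uF.
- move=> q Vq i j; rewrite DE//.
  have [Wz _] := Uz q (VU _ Vq).
  rewrite (@near_eq_derive _ _ _ _ (fun y : 'rV[R]_k => y 0 j)); last first.
    apply: (open_near_eq oW) Wz => y Wy /=.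
    by have [_ /rowP/(_ j)] := Wg y Wy; rewrite mxE.
  have [_ ->] := is_derive_coord j (\row_i z i q) (e i).
  by rewrite mxE eqxx.
Qed.

Lemma frame_extend M k V z D p (v : Tan p) : @frame M k V z D -> V p ->
  exists2 X : vfield M, smooth_vfield X & X p = v.
Proof.
move=> [oV sz sD Vv VD] Vp; exists (fun q => \sum_i v (z i) *: D i q); last first.
  by rewrite -Vv.
move=> f sf; under eq_fun do rewrite tan_sumE.
apply: sm_sum => [|i]; first exact: smP.
by apply: smZ; [exact: smP|exact: sD].
Qed.

End LocalCharts.

(** * The cotangent bundle *)

Section Cotangent.
Variable R : realType.

(** * Lie bracket and exterior derivative *)

Lemma lie_bracketE (M : dspace R) (X Y : vfield M) p f :
  smooth_vfield X -> smooth_vfield Y -> sm f ->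
  lie_bracket X Y p f = X p (fun q => Y q f) - Y p (fun q => X q f).
Proof.
move=> sX sY sf; rewrite /lie_bracket insubdK//; apply/asboolP; split.
- move=> a f1 f2 s1 s2.
  under [Z in X p Z]eq_fun do rewrite tan_linear//.
  under [Z in Y p Z]eq_fun do rewrite tan_linear//.
  rewrite !tan_linear//; try exact: sX; try exact: sY.
  ring.
- move=> f1 f2 s1 s2.
  under [Z in X p Z]eq_fun do rewrite tanM//.
  under [Z in Y p Z]eq_fun do rewrite tanM//.
  have sXf g : sm g -> sm (fun q => X q g) by exact: sX.
  have sYf g : sm g -> sm (fun q => Y q g) by exact: sY.
  have sMf g1 g2 : sm g1 -> sm g2 -> sm (fun q : M => g1 q * g2 q).
    by move=> *; apply: smM => //; exact: smP.
  do 2 (rewrite tanD; [|by apply: sMf => //; (exact: sXf || exact: sYf)..]).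
  rewrite !tanM//; try exact: sXf; try exact: sYf.
  ring.
- move=> g ng.
  have E (Z : vfield M) : (fun q => Z q g) = fun=> 0.
    by apply/funext => q; have [_ _ ->] := derivation_tan (Z q).
  by rewrite !E !tan_cst subrr.
Qed.

(** Existence of extensions keeps [xget] away from its default, and a value common to all extensions
    makes its choice irrelevant. *)
Lemma ext_d_eq (M : dspace R) (a : form1 M) p (u v : Tan p) (r : R) :
  (exists2 X : vfield M, smooth_vfield X & X p = u) ->
  (exists2 Y : vfield M, smooth_vfield Y & Y p = v) ->
  (forall X Y : vfield M, smooth_vfield X -> smooth_vfield Y -> X p = u -> Y p = v ->
     X p (fun q => a q (Y q)) - Y p (fun q => a q (X q)) -
       a p (lie_bracket X Y p) = r) ->
  ext_d a u v = r.
Proof.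
move=> [X sX Xu] [Y sY Yv] H; rewrite /ext_d.
set S := [set r0 | _]; have Sr s : S s -> s = r.
  by move=> [X' [Y' [? ? ? ? ->]]]; exact: H.
have S0 : S r by exists X, Y; rewrite H.
by case: xgetP => [s _ /Sr//|/(_ r)].
Qed.

(** * Canonical coordinates on the cotangent bundle *)

Variable Q : dspace R.
Implicit Types (q : Q) (b : Tstar Q).

Lemma smooth_pi_Q : smooth (@pi_Q R Q).
Proof.
move=> f sf; apply: (@sm_gen R _ _ (f \o pi_Q)); left; exists f => //.
Qed.

Lemma sm_ev (X : vfield Q) : smooth_vfield X ->
  sm (d := Tstar Q) (fun b => ct_fun b (X (ct_base b))).
Proof. by move=> sX; apply: sm_gen; right; exists X. Qed.

Lemma liouvilleE b (w : Tan b) : liouville b w = ct_fun b (tmap pi_Q w).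
Proof.
rewrite /liouville linearizeE// => a u v.
rewrite /tmap dmap_linear//; last exact: smooth_pi_Q.
exact: ldual_linear.
Qed.

(** The covector with components c in the basis of the differentials of the x i; it gives the
    inverse of the fibre coordinates. *)
Definition mkcov k (x : 'I_k -> Q -> R) (c : 'I_k -> R) (q : Q) : Tstar Q :=
  @Covector R Q q (linearize (fun v : Tan q => \sum_i c i * v (x i))).

Lemma mkcovE k (x : 'I_k -> Q -> R) c q v :
  ct_fun (mkcov x c q) v = \sum_i c i * v (x i).
Proof.
rewrite linearizeE// => a u w; rewrite mulr_sumr -big_split.
by apply: eq_bigr => i _; rewrite tan_linearE /=; ring.
Qed.

Lemma frame_covector k U (x : 'I_k -> Q -> R) D b : frame U x D -> U (ct_base b) ->
  b = mkcov x (fun i => ct_fun b (D i (ct_base b))) (ct_base b).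
Proof.
case: b => q a [oU sx sD UD _] /= Uq.
rewrite /mkcov; congr Covector; apply: val_inj; apply/funext => v /=.
rewrite -[RHS]/(ct_fun (mkcov x (fun i => a (D i q)) q) v) mkcovE.
by rewrite {1}(UD q Uq v) ldual_sum; apply: eq_bigr => i _; rewrite mulrC.
Qed.

Definition cot_coord k (x : 'I_k -> Q -> R) (D : 'I_k -> vfield Q) (i : 'I_(k + k))
    (b : Tstar Q) : R :=
  match fintype.split i with
  | inl i => x i (ct_base b)
  | inr i => ct_fun b (D i (ct_base b))
  end.

Lemma sm_cot_coord k (x : 'I_k -> Q -> R) D i : (forall i, sm (x i)) ->
  (forall i, smooth_vfield (D i)) -> sm (cot_coord x D i).
Proof.
move=> sx sD; rewrite /cot_coord; case: fintype.split => j.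
  exact: smooth_pi_Q (sx j).
exact: sm_ev.
Qed.

Lemma lchart_Tstar k U W (x : 'I_k -> Q -> R) g D :
  lchart U W x g -> frame U x D ->
  lchart (@pi_Q R Q @^-1` U) (lsubmx @^-1` W) (cot_coord x D)
    (fun zeta => mkcov x (fun i => rsubmx zeta 0 i) (g (lsubmx zeta))).
Proof.
move=> [[oU oW] sx Ux Wg Cg] fr; have [_ _ sD UD UDx] := fr.
set g' := fun zeta => _.
have oW' : open ((lsubmx : 'rV[R]_(k + k) -> 'rV[R]_k) @^-1` W).
  apply: open_comp => // zeta _.
  rewrite (_ : lsubmx = fun z : 'rV[R]_(k + k) => \row_i z 0 (lshift k i)).
    by apply: continuous_row_at => i; exact: coord_continuous.
  by apply/funext => z; apply/rowP => i; rewrite !mxE.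
have lz b : lsubmx (\row_i cot_coord x D i b) = \row_i x i (ct_base b).
  by apply/rowP => i; rewrite !mxE /cot_coord (unsplitK (inl i)).
have rz b i : rsubmx (\row_i cot_coord x D i b) 0 i = ct_fun b (D i (ct_base b)).
  by rewrite !mxE /cot_coord (unsplitK (inr i)).
have Cl (V : set 'rV[R]_(k + k)) i : Cinf V (fun z => lsubmx z 0 i).
  have -> : (fun z : 'rV[R]_(k + k) => lsubmx z 0 i) = fun z => z 0 (lshift k i).
    by apply/funext => z; rewrite mxE.
  by move=> j; exact: Cdiff_coord.
have Cr (V : set 'rV[R]_(k + k)) i : Cinf V (fun z => rsubmx z 0 i).
  have -> : (fun z : 'rV[R]_(k + k) => rsubmx z 0 i) = fun z => z 0 (rshift k i).
    by apply/funext => z; rewrite mxE.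
  by move=> j; exact: Cdiff_coord.
have rowl (z : 'rV[R]_(k + k)) : \row_i lsubmx z 0 i = lsubmx z.
  by apply/rowP => i; rewrite mxE.
have CF F : sm F -> Cinf (lsubmx @^-1` W) (fun z : 'rV[R]_(k + k) => F (g (lsubmx z))).
  move=> sF; have := @Cinf_comp R k (k + k) W _ (F \o g)
    (fun i z => lsubmx z 0 i) oW oW'.
  under [in X in _ -> _ -> _ -> X]eq_fun do rewrite rowl.
  apply=> [z Wz||]; [by rewrite rowl|exact: Cg|exact: Cl].
split=> //.
- by split=> //; apply: dopen_preimage => //; exact: smooth_pi_Q.
- by move=> i; exact: sm_cot_coord.
- move=> b Ub; rewrite /= /g' lz; have [Wx gx] := Ux _ Ub; split=> //.
  rewrite gx [RHS](frame_covector fr Ub); congr mkcov.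
  by apply/funext => i; rewrite rz.
- move=> zeta Wz; have [Ug xg] := Wg _ Wz; split=> //.
  apply/rowP => i; rewrite mxE /cot_coord.
  case: (fintype.split_ordP i) => j ->.
    by move/rowP : xg => /(_ j); rewrite !mxE.
  rewrite /g' mkcovE/= (bigD1 j)//= UDx// eqxx mulr1 big1 ?addr0 ?mxE// => l lj.
  by rewrite UDx// (negbTE lj) mulr0.
(* Functions that become smooth in the parameters form a differential structure, so only the
   generators are checked. Evaluation on a field X becomes the sum of p_i X(x_i). *)
- move=> F /(_ [set K : Tstar Q -> R | Cinf (lsubmx @^-1` W) (K \o g')]); apply.
    split=> [{}F lF|m f u Cf Cu].
      apply: Cinf_bigcup => z Wz; have [G [V [CG oV Vz FG]]] := lF (g' z) I.
      pose V' := [set z | (lsubmx @^-1` W) z /\ V (g' z)].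
      exists V'; split=> //; apply: (@eq_Cinf _ _ _ (G \o g')).
      + by apply: open_pull oV.
      + by move=> y [_ Vy] /=; rewrite FG.
      + by move=> j; apply: Cdiff_subset (CG j) => y [].
    by apply: (@Cinf_comp R m (k + k) setT _ u (fun i => f i \o g')) => //; exact: openT.
  move=> _ [[f sf ->]|[X sX ->]]; first exact: CF.
  rewrite /= (_ : _ \o _ = fun z : 'rV[R]_(k + k) =>
      \sum_i rsubmx z 0 i * X (g (lsubmx z)) (x i)).
    move=> j; apply: Cdiff_sum => // i; apply: CdiffM => //; first exact: Cr.
    exact: (CF _ (sX _ (sx i))).
  by apply/funext => z; rewrite /g' /= mkcovE.
Qed.

Variable n : nat.
Hypothesis locQ : forall q : Q,
  exists (U : set Q) (x : Q -> 'rV[R]_n), U q /\ chart U x.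

Lemma manifold_frame q : exists U W x g D,
  [/\ @lchart R Q n U W x g, frame U x D & U q].
Proof.
have [U0 [x0 [U0q cx]]] := locQ q.
have [U [W [x [g [lc Uq]]]]] := chart_lchart cx U0q.
have [V [D [fr Vq VU]]] := lchart_frame lc Uq.
exists V, [set xi | W xi /\ V (g xi)], x, g, D; split=> //.
by apply: lchart_restrict lc _ VU; have [] := fr.
Qed.

Lemma Tstar_frame b : exists U (z : 'I_(n + n) -> Tstar Q -> R) D, frame U z D /\ U b.
Proof.
have [U [W [x [g [D [lc fr Uq]]]]]] := manifold_frame (ct_base b).
have [V [D' [fr' Vb _]]] := lchart_frame (lchart_Tstar lc fr) (Uq : (pi_Q @^-1` U) b).
by exists V, (cot_coord x D), D'.
Qed.

Lemma Tstar_extend b (v : Tan b) :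
  exists2 X : vfield (Tstar Q), smooth_vfield X & X b = v.
Proof.
by have [U [z [D [fr Ub]]]] := Tstar_frame b; exact: frame_extend fr Ub.
Qed.

(** * Local formulas for the Liouville and symplectic forms *)

Section Local.
Variables (U : set Q) (x : 'I_n -> Q -> R) (D : 'I_n -> vfield Q).
Hypothesis fr : frame U x D.

Definition fiber_coord i : Tstar Q -> R := fun b => ct_fun b (D i (ct_base b)).

Lemma sm_fiber_coord i : sm (fiber_coord i).
Proof. by have [_ _ sD _ _] := fr; exact: sm_ev. Qed.

Lemma sm_base i : sm (x i \o pi_Q : Tstar Q -> R).
Proof. by have [_ sx _ _ _] := fr; exact: smooth_pi_Q. Qed.

Lemma liouville_local b (w : Tan b) : U (ct_base b) ->
  liouville b w = \sum_i fiber_coord i b * w (x i \o pi_Q).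
Proof.
move=> Ub; have [oU sx sD UD UDx] := fr.
rewrite liouvilleE (UD _ Ub (tmap pi_Q w)) ldual_sum; apply: eq_bigr => i _.
by rewrite mulrC dmapE//; exact: smooth_pi_Q.
Qed.

End Local.

(** Smoothness is local, and locally the form is the sum of p_i dx_i. It is needed because
    [tan_local] compares globally smooth functions only. *)
Lemma sm_liouville (Y : vfield (Tstar Q)) : smooth_vfield Y ->
  sm (fun b => liouville b (Y b)).
Proof.
move=> sY; apply: (smP (Tstar Q)).1 => b _.
have [U [W [x [g [D [lc fr Ub]]]]]] := manifold_frame (ct_base b).
exists (fun b => \sum_i fiber_coord D i b * Y b (x i \o pi_Q)),
  (pi_Q @^-1` U); split=> //.
- apply: (sm_sum (smP (Tstar Q))) => i; apply: (smM (smP (Tstar Q))).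
    exact: sm_fiber_coord fr i.
  exact: sY (sm_base fr i).
- by apply: dopen_preimage; [exact: smooth_pi_Q|have [] := fr].
- by move=> c Uc; exact: (liouville_local fr).
Qed.

(** With the Liouville form written as the sum of p_i dx_i, the terms that differentiate the
    extensions cancel against the bracket term. What remains is the sum of dx_i wedge dp_i on u and
    v, whatever the extensions. *)
Lemma omega_Q_local U (x : 'I_n -> Q -> R) D b (u v : Tan b) : frame U x D ->
  U (ct_base b) ->
  omega_Q b u v = \sum_i (u (x i \o pi_Q) * v (fiber_coord D i) -
                          v (x i \o pi_Q) * u (fiber_coord D i)).
Proof.
move=> fr Ub; rewrite /omega_Q.
rewrite (@ext_d_eq _ _ _ _ _ (\sum_i (v (x i \o pi_Q) * u (fiber_coord D i) -
                                      u (x i \o pi_Q) * v (fiber_coord D i)))).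
- by rewrite -sumrN; apply: eq_bigr => i _; rewrite opprB.
- exact: Tstar_extend.
- exact: Tstar_extend.
move=> X Y sX sY Xu Yv.
have oU : dopen (pi_Q @^-1` U : set (Tstar Q)).
  by apply: dopen_preimage; [exact: smooth_pi_Q|have [] := fr].
have E (Z Z' : vfield (Tstar Q)) : smooth_vfield Z -> smooth_vfield Z' ->
    Z b (fun c => liouville c (Z' c)) =
    \sum_i (fiber_coord D i b * Z b (fun c => Z' c (x i \o pi_Q)) +
            Z' b (x i \o pi_Q) * Z b (fiber_coord D i)).
  move=> sZ sZ'.
  have sm2 i : sm (fun c => Z' c (x i \o pi_Q)) by apply: sZ'; exact: sm_base fr _.
  have sm1 i : sm (fun c => fiber_coord D i c * Z' c (x i \o pi_Q)).
    exact: (smM (smP (Tstar Q)) (sm_fiber_coord fr i) (sm2 i)).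
  rewrite (@tan_local _ _ _ _ _ _
    (fun c => \sum_i fiber_coord D i c * Z' c (x i \o pi_Q)) oU Ub) //.
  + rewrite tan_sum//; apply: eq_bigr => i _; rewrite tanM//.
    exact: sm_fiber_coord fr _.
  + exact: sm_liouville.
  + exact: (sm_sum (smP (Tstar Q))).
  + by move=> c Uc; exact: (liouville_local fr).
rewrite (E X Y)// (E Y X)// (liouville_local fr)// -!sumrB; apply: eq_bigr => i _.
rewrite lie_bracketE//; last exact: sm_base fr _.
by rewrite Xu Yv; ring.
Qed.

End Cotangent.

(** * The forms defined by a Hamiltonian section *)

Section Hamiltonian.
Variables (R : realType) (n : nat) (Q : dspace R).
Hypothesis locQ : forall q : Q,
  exists (U : set Q) (x : Q -> 'rV[R]_n), U q /\ chart U x.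
Variable Pi : Q -> Rline R.
Hypothesis sPi : smooth Pi.
Implicit Types (q : Q) (a : Tstar Q) (b : Vstar Pi).

Lemma sm_id_Rline : sm (d := Rline R) (id : R -> R).
Proof. exact: sm_gen. Qed.

Lemma dfunE (M : dspace R) (f : M -> R) (p : M) (v : Tan p) : dfun f p v = v f.
Proof. by rewrite /dfun linearizeE. Qed.

Lemma pull1_dt (M : dspace R) (f : M -> Rline R) (p : M) (v : Tan p) :
  smooth f -> pull1 f (@dt R) p v = v (f : M -> R).
Proof.
move=> sf; rewrite /pull1 linearizeE => [|c u w].
  by rewrite dfunE /tmap dmapE//; exact: sm_id_Rline.
by rewrite /tmap dmap_linear// ldual_linear.
Qed.

Lemma sm_Pi : sm (Pi : Q -> R).
Proof. exact: sPi sm_id_Rline. Qed.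

Lemma etaE q (v : Tan q) : eta_form Pi q v = v (Pi : Q -> R).
Proof. exact: pull1_dt. Qed.

Lemma eta_0E a (v : Tan a) : eta_0 Pi a v = v ((Pi : Q -> R) \o pi_Q).
Proof. by apply: pull1_dt; apply: smooth_comp sPi; exact: smooth_pi_Q. Qed.

Lemma ver_eta q (u : Ver Pi q) : (val u : Tan q) (Pi : Q -> R) = 0.
Proof. by rewrite -etaE; apply/eqP; exact: kerlP. Qed.

Lemma smooth_tau : smooth (tau Pi).
Proof. by move=> f sf; apply: (@sm_gen R _ _ (f \o tau Pi)); left; exists f. Qed.

Lemma muE a (u : Ver Pi (ct_base a)) : v_fun (mu Pi a) u = ct_fun a (val u).
Proof.
by rewrite /= linearizeE// => c v w; rewrite -ldual_linear.
Qed.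

Lemma smooth_mu : smooth (mu Pi).
Proof.
apply: smooth_gen => _ [[f sf ->]|[X sX ->]]; first exact: smooth_pi_Q.
rewrite (_ : _ \o _ = fun a : Tstar Q => ct_fun a (val (X (ct_base a)) : Tan _)).
  exact: sm_ev sX.
by apply/funext => a; exact: muE.
Qed.

Lemma psiE s a (v : Tan (ct_base a)) :
  ct_fun (psi Pi s a) v = ct_fun a v + s * v (Pi : Q -> R).
Proof. by rewrite -etaE. Qed.

Lemma smooth_psi s : smooth (psi Pi s).
Proof.
apply: smooth_gen => _ [[f sf ->]|[X sX ->]]; first exact: smooth_pi_Q.
rewrite (_ : _ \o _ = fun a : Tstar Q => ct_fun a (X (ct_base a)) +
    s * X (ct_base a) (Pi : Q -> R)); last by apply/funext => a; exact: psiE.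
apply: (smD (smP (Tstar Q))); first exact: sm_ev.
by apply: (smZ (smP (Tstar Q))); exact: smooth_pi_Q (sX _ sm_Pi).
Qed.

Lemma mu_psi s a : mu Pi (psi Pi s a) = mu Pi a.
Proof.
rewrite /mu /=; congr VCovector; congr linearize; apply/funext => u.
by rewrite -[LHS]/(ct_fun (psi Pi s a) (val u)) psiE ver_eta mulr0 addr0.
Qed.

Lemma tan_base_local U (x : 'I_n -> Q -> R) D a (w : Tan a) f :
  frame U x D -> U (ct_base a) -> sm f ->
  w (f \o pi_Q) = \sum_i w (x i \o pi_Q) * D i (ct_base a) f.
Proof.
move=> fr Ua sf; have [_ sx _ UD _] := fr.
transitivity (tmap pi_Q w f); first by rewrite /tmap dmapE//; exact: smooth_pi_Q.
rewrite {1}(UD _ Ua (tmap pi_Q w)) tan_sumE; apply: eq_bigr => i _.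
by congr (_ * _); rewrite /tmap dmapE//; exact: smooth_pi_Q.
Qed.

(* The exterior derivative of the pullback of dPi to the cotangent bundle
   vanishes. *)
Lemma closed_dPi U (x : 'I_n -> Q -> R) D a (u v : Tan a) :
  frame U x D -> U (ct_base a) ->
  let g i : Tstar Q -> R := (fun q => D i q (Pi : Q -> R)) \o pi_Q in
  \sum_i (u (x i \o pi_Q) * v (g i) - v (x i \o pi_Q) * u (g i)) = 0.
Proof.
move=> fr Ua g; have [oU sx sD UD UDx] := fr.
have [X sX Xu] := Tstar_extend locQ u.
have [Y sY Yv] := Tstar_extend locQ v.
have oU' : dopen (pi_Q @^-1` U : set (Tstar Q)).
  by apply: dopen_preimage => //; exact: smooth_pi_Q.
have sg i : sm (g i) by exact: smooth_pi_Q (sD i _ sm_Pi).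
have sb i : sm (x i \o pi_Q : Tstar Q -> R) by exact: smooth_pi_Q.
have sP : sm ((Pi : Q -> R) \o pi_Q : Tstar Q -> R) by exact: smooth_pi_Q sm_Pi.
have E (Z Z' : vfield (Tstar Q)) : smooth_vfield Z -> smooth_vfield Z' ->
    Z a (fun c => Z' c ((Pi : Q -> R) \o pi_Q)) =
    \sum_i (Z' a (x i \o pi_Q) * Z a (g i) + g i a * Z a (fun c => Z' c (x i \o pi_Q))).
  move=> sZ sZ'.
  have s1 i : sm (fun c => Z' c (x i \o pi_Q) * g i c).
    exact: (smM (smP (Tstar Q)) (sZ' _ (sb i)) (sg i)).
  rewrite (@tan_local _ _ _ (Z a) _ _
    (fun c => \sum_i Z' c (x i \o pi_Q) * g i c) oU' Ua).
  + rewrite tan_sum//; apply: eq_bigr => i _; rewrite tanM//; exact: sZ'.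
  + exact: sZ'.
  + exact: (sm_sum (smP (Tstar Q))).
  + by move=> c Uc; rewrite (tan_base_local _ fr)//; exact: sm_Pi.
(* The bracket applied to Pi o pi_Q is computed directly and through its values on the x_i. The
   second-order terms agree, and the remaining terms are the claim. *)
have := lie_bracketE a sX sY sP; rewrite (E X Y)// (E Y X)//.
rewrite (tan_base_local _ fr)//; last exact: sm_Pi.
under [in LHS]eq_bigr do rewrite lie_bracketE//.
rewrite Xu Yv -sumrB => /eqP; rewrite -subr_eq0 -sumrB => /eqP H.
rewrite -[RHS]H; apply: eq_bigr => i _; rewrite /g/=; ring.
Qed.

Lemma Tstar_coordinates U W (x : 'I_n -> Q -> R) g D a :
  lchart U W x g -> frame U x D -> U (ct_base a) ->
  (forall c d : 'I_n -> R, exists Y : Tan a, forall j,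
     Y (x j \o pi_Q) = c j /\ Y (fiber_coord D j) = d j) /\
  (forall E : Tan a,
     (forall j, E (x j \o pi_Q) = 0 /\ E (fiber_coord D j) = 0) -> E = 0).
Proof.
move=> lc fr Ua.
have [V [D' [fr' Va _]]] := lchart_frame (lchart_Tstar lc fr) (Ua : (pi_Q @^-1` U) a).
have [_ _ _ VD' D'z] := fr'.
have zl j : cot_coord x D (lshift n j) = x j \o pi_Q.
  by apply/funext => c; rewrite /cot_coord (unsplitK (inl j)).
have zr j : cot_coord x D (rshift n j) = fiber_coord D j.
  by apply/funext => c; rewrite /cot_coord (unsplitK (inr j)).
split=> [c d|E E0].
  pose w (i : 'I_(n + n)) := match fintype.split i with inl j => c j | inr j => d j end.
  exists (\sum_i w i *: D' i a).
  have wz i : (\sum_i w i *: D' i a) (cot_coord x D i) = w i.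
    rewrite tan_sumE (bigD1 i)//= D'z// eqxx mulr1 big1 ?addr0// => l li.
    by rewrite D'z// eq_sym (negbTE li) mulr0.
  move=> j; rewrite -zl -zr !wz /w.
  by rewrite (unsplitK (inl j)) (unsplitK (inr j)).
rewrite (VD' _ Va E) big1// => i _.
suff -> : E (cot_coord x D i) = 0 by rewrite scale0r.
by case: (fintype.split_ordP i) => j ->; rewrite ?zl ?zr; have [] := E0 j.
Qed.

(** Pairing E with the coordinate vector along p_j isolates E(x_j), and with the one along x_j
    isolates - E(p_j). *)
Lemma Tstar_nondegenerate a (E : Tan a) :
  (forall v : Tan a, omega_Q a E v = 0) -> E = 0.
Proof.
move=> E0; have [U [W [x [g [D [lc fr Ua]]]]]] := manifold_frame locQ (ct_base a).
have [ex det] := Tstar_coordinates lc fr Ua; apply: det => j; split.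
- have [Y YE] := ex (fun=> 0) (fun i => (i == j)%:R).
  have := E0 Y; rewrite (omega_Q_local locQ _ _ fr Ua) (bigD1 j)//=.
  have [-> ->] := YE j; rewrite eqxx mulr1 mul0r subr0 big1 ?addr0// => i ij.
  by have [-> ->] := YE i; rewrite (negbTE ij) mulr0 mul0r subr0.
- have [Y YE] := ex (fun i => (i == j)%:R) (fun=> 0).
  have := E0 Y; rewrite (omega_Q_local locQ _ _ fr Ua) (bigD1 j)//=.
  have [-> ->] := YE j; rewrite eqxx mul1r mulr0 sub0r big1 ?addr0 => [H|i ij].
    by apply/eqP; rewrite -oppr_eq0 H.
  by have [-> ->] := YE i; rewrite (negbTE ij) mulr0 mul0r subr0.
Qed.

(** Since [ext_d] is defined by a choice, this and the additivity that follows are read off the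
    local formula. *)
Lemma omega_Q_alternating a (u : Tan a) : omega_Q a u u = 0.
Proof.
have [U [W [x [g [D [lc fr Ua]]]]]] := manifold_frame locQ (ct_base a).
by rewrite (omega_Q_local locQ _ _ fr Ua) big1// => i _; rewrite subrr.
Qed.

Lemma omega_QB a (u u' v : Tan a) :
  omega_Q a (u - u') v = omega_Q a u v - omega_Q a u' v.
Proof.
have [U [W [x [g [D [lc fr Ua]]]]]] := manifold_frame locQ (ct_base a).
rewrite !(omega_Q_local locQ _ _ fr Ua) -sumrB; apply: eq_bigr => i _.
have subE f : (u - u') f = u f - u' f by [].
by rewrite !subE /=; ring.
Qed.

(** * The extended Hamiltonian and the two vector fields *)

Section Extended.
Variables (h : Vstar Pi -> Tstar Q) (F : Tstar Q -> R).
Hypotheses (sh : smooth h) (muh : forall b, mu Pi (h b) = b).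
Hypothesis Fext : extended_hamiltonian h F.
Hypothesis eta1 : forall q, exists v : Tan q, v (Pi : Q -> R) = 1.

Lemma base_hmu a : ct_base (h (mu Pi a)) = ct_base a.
Proof. exact: (congr1 (tau Pi) (muh (mu Pi a))). Qed.

Lemma smooth_hmu : smooth (h \o mu Pi).
Proof. exact: smooth_comp smooth_mu sh. Qed.

Lemma ev_hmu (X : vfield Q) a :
  let ev := fun a => ct_fun a (X (ct_base a)) in
  ev (h (mu Pi a)) = ev a - F a * X (ct_base a) (Pi : Q -> R).
Proof.
move=> ev; have H : ev (psi Pi (F a) (h (mu Pi a))) = ev (h (mu Pi a)) +
    F a * X (ct_base (h (mu Pi a))) (Pi : Q -> R) by exact: psiE.
by rewrite {2}(Fext a) H base_hmu addrK.
Qed.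

(** F is only given by a pointwise equation. Evaluating that equation on a field Y extending a
    vector with eta equal to 1 expresses F near a as a smooth function divided by eta(Y), which
    stays above 1/2 there. *)
Lemma sm_F : sm F.
Proof.
apply: (smP (Tstar Q)).1 => a _.
have [v v1] := eta1 (ct_base a).
have [U [W [x [g [D [lc fr Ua]]]]]] := manifold_frame locQ (ct_base a).
have [Y sY Yv] := frame_extend v fr Ua.
pose ev : Tstar Q -> R := fun a => ct_fun a (Y (ct_base a)).
pose e : Tstar Q -> R := (fun q => Y q (Pi : Q -> R)) \o pi_Q.
have se : sm e by exact: smooth_pi_Q (sY _ sm_Pi).
have sev : sm ev by exact: sm_ev.
have ea : e a = 1 by rewrite /e /= Yv.
pose O := [set c | 2^-1 < e c].
have oO : dopen (O : set (Tstar Q)) by apply: (iopen_gt (smP (Tstar Q))).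
have Oa : O a by rewrite /O/= ea; lra.
have e0 c : O c -> e c != 0 by rewrite /O /= => ec; rewrite gt_eqF//; lra.
have [k [V [sk oV Va ke]]] := sm_inv (smP (Tstar Q)) se e0 Oa.
exists (fun c => (ev c - ev (h (mu Pi c))) * k c), (V `&` O); split=> //.
- apply: (smM (smP (Tstar Q))) => //; apply: (smB (smP (Tstar Q))) => //.
  exact: smooth_hmu sev.
- exact: iopenI.
- move=> c [Vc Oc]; rewrite -ke// [ev (h _)](ev_hmu Y c) opprB addrC subrK.
  by rewrite mulfK//; exact: e0 c Oc.
Qed.

(** With c_i = D_i Pi, the map [h \o mu Pi] fixes x_i and sends p_i to p_i - F c_i. The extra terms
    are dF wedge eta_0, as the sum of c_i dx_i is eta_0, and F times the sum of dx_i wedge dc_i,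
    which vanishes by [closed_dPi]. *)
Lemma omega_h_pullback a (u v : Tan a) :
  pull2 (h \o mu Pi) omega_Q u v = omega_h Pi F a u v.
Proof.
have [U [W [x [g [D [lc fr Ua]]]]]] := manifold_frame locQ (ct_base a).
have [oU sx sD _ _] := fr.
pose c i : Tstar Q -> R := (fun q => D i q (Pi : Q -> R)) \o pi_Q.
have sc i : sm (c i) by exact: smooth_pi_Q (sD i _ sm_Pi).
have Uf : U (ct_base ((h \o mu Pi) a)) by rewrite /= base_hmu.
have xf i : (x i \o pi_Q) \o (h \o mu Pi) = x i \o pi_Q.
  by apply/funext => d; rewrite /= /pi_Q base_hmu.
have Pf i : fiber_coord D i \o (h \o mu Pi) = fun d => fiber_coord D i d - F d * c i d.
  by apply/funext => d; exact: (ev_hmu (D i) d).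
have sFc i : sm (fun d => F d * c i d) by exact: (smM (smP (Tstar Q)) sm_F (sc i)).
have dF (w : Tan a) i : tmap (h \o mu Pi) w (fiber_coord D i) =
    w (fiber_coord D i) - (F a * w (c i) + c i a * w F).
  rewrite /tmap dmapE//; [|exact: smooth_hmu|exact: sm_fiber_coord fr i].
  rewrite Pf tanB; [|exact: sm_fiber_coord fr i|exact: sFc].
  by rewrite tanM//; exact: sm_F.
have dx (w : Tan a) i : tmap (h \o mu Pi) w (x i \o pi_Q) = w (x i \o pi_Q).
  by rewrite /tmap dmapE ?xf//; [exact: smooth_hmu|exact: sm_base fr i].
rewrite /pull2 (omega_Q_local locQ _ _ fr Uf) /omega_h /wedge.
rewrite (omega_Q_local locQ _ _ fr Ua) !dfunE !eta_0E.
rewrite !(tan_base_local _ fr Ua sm_Pi).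
have cl := congr1 ( *%R (F a)) (closed_dPi u v fr Ua).
rewrite mulr0 in cl; rewrite -[LHS]addr0 -[X in _ + X = _]cl.
rewrite !mulr_sumr -sumrB -!big_split /=; apply: eq_bigr => i _.
by rewrite !dx !dF /c /=; ring.
Qed.

Lemma hmu_h : (h \o mu Pi) \o h = h.
Proof. by apply/funext => b /=; rewrite muh. Qed.

Lemma F_h b : F (h b) = 0.
Proof.
have [v v1] := eta1 (ct_base (h b)).
have [U [W [x [g [D [lc fr Ub]]]]]] := manifold_frame locQ (ct_base (h b)).
have [Y sY Yv] := frame_extend v fr Ub.
have := ev_hmu Y (h b); cbv zeta; rewrite muh Yv v1; lra.
Qed.

(* The infinitesimal generator of the R-action psi. *)
Lemma vertical_tan a : exists Y : Tan a,
  [/\ dmap (mu Pi) (mu Pi a) Y = 0, Y F = 1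
    & forall u : Tan a, omega_Q a u Y = u ((Pi : Q -> R) \o pi_Q)].
Proof.
have [U [W [x [g [D [lc fr Ua]]]]]] := manifold_frame locQ (ct_base a).
have [oU sx sD UD _] := fr.
pose c i : Tstar Q -> R := (fun q => D i q (Pi : Q -> R)) \o pi_Q.
have sc i : sm (c i) by exact: smooth_pi_Q (sD i _ sm_Pi).
(* Translation along eta fixes the x_i and moves each p_i at speed c_i, the component of eta. *)
have [/(_ (fun=> 0) (c ^~ a))[Y YE] _] := Tstar_coordinates lc fr Ua.
have Y0 f : sm f -> Y (f \o pi_Q) = 0.
  move=> sf; rewrite (tan_base_local _ fr)// big1// => i _.
  by have [-> _] := YE i; rewrite mul0r.
have muY : dmap (mu Pi) (mu Pi a) Y = 0.
  apply: tan_gen => f Gf.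
  rewrite (dmapE _ smooth_mu (erefl _) (sm_gen Gf)).
  case: Gf => [[k sk ->]|[X sX ->]]; first exact: Y0.
  pose Z : vfield Q := fun q => val (X q).
  have -> : (fun b : Vstar Pi => v_fun b (X (v_base b))) \o mu Pi =
      (fun d : Tstar Q => ct_fun d (Z (ct_base d))).
    by apply/funext => d; exact: muE.
  have sZx i : sm ((fun q => Z q (x i)) \o pi_Q : Tstar Q -> R).
    exact: smooth_pi_Q (sX _ (sx i)).
  have sp i := smM (smP (Tstar Q)) (sZx i) (sm_fiber_coord fr i).
  have oU' : dopen (pi_Q @^-1` U : set (Tstar Q)).
    by apply: dopen_preimage => //; exact: smooth_pi_Q.
  rewrite (@tan_local _ _ _ Y _ _ (fun d => \sum_i
      ((fun q => Z q (x i)) \o pi_Q) d * fiber_coord D i d) oU' Ua).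
  - rewrite tan_sum//.
    transitivity (Z (ct_base a) (Pi : Q -> R)); last exact: ver_eta.
    rewrite {1}(UD _ Ua (Z (ct_base a))) tan_sumE; apply: eq_bigr => i _.
    rewrite tanM//; [|exact: sm_fiber_coord fr i].
    by rewrite (Y0 _ (sX _ (sx i))) mulr0 addr0; have [_ ->] := YE i.
  - exact: sm_ev sX.
  - exact: (sm_sum (smP (Tstar Q))).
  - move=> d Ud; rewrite {1}(UD _ Ud (Z (ct_base d))) ldual_sum.
    by apply: eq_bigr.
exists Y; split=> //.
(* Since T mu kills Y, the function p_i o h o mu = p_i - F c_i has derivative 0 along Y, while
   Y(p_i) = c_i and Y(c_i) = 0. *)
- have YF i : c i a * (1 - Y F) = 0.
    have : Y (fiber_coord D i \o (h \o mu Pi)) = 0.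
      transitivity (dmap (mu Pi) (mu Pi a) Y (fiber_coord D i \o h));
        last by rewrite muY.
      by rewrite (dmapE _ smooth_mu (erefl _))//; exact: sh (sm_fiber_coord fr i).
    have -> : fiber_coord D i \o (h \o mu Pi) =
        fun d => fiber_coord D i d - F d * c i d.
      by apply/funext => d; exact: (ev_hmu (D i) d).
    have sFc := smM (smP (Tstar Q)) sm_F (sc i).
    rewrite tanB; [|exact: sm_fiber_coord fr i|exact: sFc].
    rewrite tanM//; last exact: sm_F.
    by rewrite (Y0 _ (sD i _ sm_Pi)) mulr0 add0r; have [_ ->] := YE i => <-; ring.
  (* The c_i do not all vanish: paired with v they sum to eta(v) = 1, so the factor 1 - Y F is 0. *)
  have [v v1] := eta1 (ct_base a).
  have : \sum_i v (x i) * (c i a * (1 - Y F)) = 1 - Y F.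
    transitivity (v (Pi : Q -> R) * (1 - Y F)); last by rewrite v1 mul1r.
    rewrite {2}(UD _ Ua v) tan_sumE mulr_suml.
    by apply: eq_bigr => i _; rewrite mulrA.
  by rewrite big1 => [|i _]; rewrite ?YF ?mulr0//; lra.
- move=> u; rewrite (omega_Q_local locQ _ _ fr Ua) (tan_base_local _ fr Ua sm_Pi).
  by apply: eq_bigr => i _; have [-> ->] := YE i; rewrite mul0r subr0.
Qed.

Lemma Hamiltonian_Reeb a (X : Tan a) (Z : Tan (mu Pi a)) :
  (forall v : Tan a, omega_Q a X v = v F) ->
  (forall w, Omega_h h (mu Pi a) Z w = 0) -> Z ((Pi : Q -> R) \o tau Pi) = 1 ->
  dmap (mu Pi) (mu Pi a) X = Z.
Proof.
move=> XF ZO Z1; set b := mu Pi a.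
have [Y [muY YF YO]] := vertical_tan a.
have X1 : X ((Pi : Q -> R) \o pi_Q) = 1 by rewrite -YO XF YF.
have Xker (v : Tan a) : pull2 (h \o mu Pi) omega_Q X v = 0.
  rewrite omega_h_pullback /omega_h /wedge !dfunE !eta_0E X1 XF.
  (* The wedge contributes X(F) eta_0(v) - v(F); the first term vanishes because X(F) = omega_Q(X,
     X) = 0, and the second cancels omega_Q(X, v). *)
  by rewrite -(XF X) omega_Q_alternating; ring.
pose d := dmap (mu Pi) b X - Z.
have sPt : sm ((Pi : Q -> R) \o tau Pi) by exact: smooth_tau sm_Pi.
have d1 : d ((Pi : Q -> R) \o tau Pi) = 0.
  have -> : d ((Pi : Q -> R) \o tau Pi) = dmap (mu Pi) b X ((Pi : Q -> R) \o tau Pi) -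
    Z ((Pi : Q -> R) \o tau Pi) by [].
  by rewrite (dmapE _ smooth_mu (erefl _) sPt) Z1 -[X in X - _]/(X _) X1 subrr.
pose E := dmap h (h b) d.
have hB (c : Tstar Q) (hc : h b = c) :
    dmap h c d = dmap h c (dmap (mu Pi) b X) - dmap h c Z.
  apply: tan_ext => f sf; rewrite [RHS]/(_ - _) (dmapE _ sh hc sf).
  by rewrite -[RHS]/(dmap h c (dmap (mu Pi) b X) f - dmap h c Z f) !(dmapE _ sh hc sf).
have E0 : E = 0.
  apply: Tstar_nondegenerate => v.
  have := omega_h_pullback E v.
  have EF : E F = 0.
    rewrite (dmapE _ sh (erefl _) sm_F) (_ : F \o h = fun=> 0) ?tan_cst//.
    by apply/funext => c; exact: F_h.
  have Eeta : E ((Pi : Q -> R) \o pi_Q) = 0.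
    rewrite (dmapE _ sh (erefl _) (smooth_pi_Q sm_Pi)) -d1; congr (d _).
    by apply/funext => c /=; rewrite /pi_Q -[in RHS](muh c).
  (* F is zero on the image of h and eta(d) is zero, so [omega_h] and [omega_Q] agree on E; the
     pairing with v is thereby expressed through T h (d). *)
  rewrite /omega_h /wedge !dfunE !eta_0E EF Eeta mul0r mulr0 subr0 addr0 => <-.
  rewrite /pull2 /tmap.
  (* All vectors are placed in the tangent space at c; the equation [hc] is eliminated only in
     statements where c is abstract. *)
  set c := (h \o mu Pi) (h b); have hc : h b = c by rewrite /c /= muh.
  rewrite (dmap_comp _ sh smooth_hmu (erefl _) (erefl _)) hmu_h hB// omega_QB.
  have -> : dmap (h \o mu Pi) c v = dmap h c (dmap (mu Pi) b v).
    by rewrite (dmap_comp _ smooth_mu sh _ hc)// muh.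
  have -> : omega_Q c (dmap h c Z) (dmap h c (dmap (mu Pi) b v)) = 0.
    move: (ZO (dmap (mu Pi) b v)); rewrite /Omega_h /pull2 /tmap.
    by rewrite -/b; case: _ / hc.
  rewrite subr0.
  (* The vector v sits at h b, whereas [Xker] concerns vectors at a. The translation by F a takes h
     b to a and does not affect the projection by mu. *)
  pose v' := dmap (psi Pi (F a)) a v.
  have pa : psi Pi (F a) (h b) = a by rewrite -(Fext a).
  have -> : dmap (mu Pi) b v = dmap (mu Pi) b v'.
    rewrite /v' (dmap_comp _ (smooth_psi _) smooth_mu pa)//.
    by apply: eq_dmap => c'; rewrite /= mu_psi.
  rewrite !(dmap_comp _ smooth_mu sh _ hc)//.
  have := Xker v'; rewrite /pull2 /tmap -/b.
  by case: _ / hc.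
have muhd : dmap (mu Pi) b E = d.
  rewrite /E (dmap_comp _ sh smooth_mu (erefl _) (muh b)).
  apply: tan_ext => f sf; rewrite dmapE//; last first.
  + exact: muh.
  + exact: smooth_comp sh smooth_mu.
  by congr (d _); apply/funext => c /=; rewrite muh.
apply/eqP; rewrite -subr_eq0 -/d -muhd E0; apply/eqP/tan_ext => f sf.
by rewrite (dmapE _ smooth_mu (muh b) sf).
Qed.

End Extended.

End Hamiltonian.

(** * Reduction *)

Section Subspace.
Variables (R : realType).
Implicit Types M N : dspace R.

Lemma smooth_val M (A : set M) : smooth (val : sub_space A -> M).
Proof. by move=> f sf; apply: sm_gen; exists f. Qed.

Lemma smooth_sub M N (A : set N) (f : M -> sub_space A) :
  smooth (val \o f : M -> N) -> smooth f.
Proof. by move=> sf; apply: smooth_gen => _ [g sg ->]; exact: sf sg. Qed.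

(** The structure of a subspace is generated by restrictions of ambient functions, so a tangent
    vector is determined by its image in the ambient space. *)
Lemma tan_sub_inj M (A : set M) (p : sub_space A) (v w : Tan p) :
  tmap (val : sub_space A -> M) v = tmap (val : sub_space A -> M) w -> v = w.
Proof.
move=> vw; apply: tan_gen => _ [f sf ->].
have := congr1 (fun t : Tan (val p) => t f) vw.
by rewrite /tmap !(dmapE _ (@smooth_val M A) (erefl _) sf).
Qed.

End Subspace.

Theorem proposition5p18 (R : realType)
  (* the fibration Pi : Q -> R *)
  (n : nat) (Q : dspace R) (Qman : is_manifold n.+1 Q)
  (Qconn : is_connected Q)
  (Pi : Q -> Rline R) (Pifib : surj_submersion Pi)
  (* the free action phi of G, and m : G -> R *)
  (G : lie_group R) (phi : G -> Q -> Q)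
  (phi_act : is_lie_action phi) (phi_free : free_action phi)
  (eta_inv : eta_invariant Pi phi)
  (m : G -> R) (m_smooth : smooth (m : lie_space G -> Rline R))
  (m_morph : forall g k, m (g * k)%g = m g + m k)
  (m_Pi : forall g q, (Pi (phi g q) : R) = (Pi q : R) + m g)
  (* the Hamiltonian section h, and its extended Hamiltonian Fh *)
  (h : Vstar Pi -> Tstar Q) (h_sec : hamiltonian_section h)
  (h_equiv : equivariant_section phi h)
  (Fh : Tstar Q -> R) (Fh_ext : extended_hamiltonian h Fh)
  (ker_cond : forall (a : Tstar Q) (u : Tan a),
     (forall v : Tan a, omega_h Pi Fh a u v = 0) -> orbit_tangent phi u -> u = 0)
  (* the momentum maps, and the level nu *)
  (J : Tstar Q -> ldual (lie_alg G)) (J_def : J = momentum phi Fh m)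
  (JV : Vstar Pi -> ldual (lie_alg G)) (JV_def : J = JV \o mu Pi)
  (nu : ldual (lie_alg G)) (nu_ne : exists a, J a = nu)
  (* the reduced spaces *)
  (k kV : nat) (Tnu Vnu : dspace R)
  (Tnu_man : is_manifold k Tnu) (Vnu_man : is_manifold kV Vnu)
  (pi_nu : sub_space [set a | J a = nu] -> Tnu)
  (piV_nu : sub_space [set b | JV b = nu] -> Vnu)
  (pi_nu_quot : is_quotient (ct_lift phi) (coad_isotropy nu) pi_nu)
  (piV_nu_quot : is_quotient (v_lift Pi phi) (coad_isotropy nu) piV_nu)
  (pi_nu_sub : surj_submersion pi_nu) (piV_nu_sub : surj_submersion piV_nu)
  (* the reduced principal bundle *)
  (mu_nu : Tnu -> Vnu) (psi_nu : R -> Tnu -> Tnu)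
  (mu_nu_def : forall (a : sub_space [set a | J a = nu])
       (b : sub_space [set b | JV b = nu]), val b = mu Pi (val a) ->
     mu_nu (pi_nu a) = piV_nu b)
  (psi_nu_def : forall s (a a' : sub_space [set a | J a = nu]),
     val a' = psi Pi s (val a) ->
     psi_nu s (pi_nu a) = pi_nu a')
  (mu_nu_bundle : principal_R_bundle mu_nu psi_nu)
  (* the reduced 2-forms *)
  (omega_nu : form2 Tnu) (omega_nu_smooth : smooth_form2 omega_nu)
  (omega_nu_def : pull2 pi_nu omega_nu =
     pull2 (val : sub_space [set a | J a = nu] -> Tstar Q) (omega_h Pi Fh))
  (Omega_nu : form2 Vnu) (Omega_nu_smooth : smooth_form2 Omega_nu)
  (Omega_nu_def : pull2 piV_nu Omega_nu =
     pull2 (val : sub_space [set b | JV b = nu] -> Vstar Pi) (Omega_h h))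
  (* the Hamiltonian vector field of Fh, and X_nu *)
  (XF : vfield (Tstar Q)) (XF_smooth : smooth_vfield XF)
  (XF_def : forall (a : Tstar Q) (v : Tan a),
     omega_Q a (XF a) v = dfun Fh a v)
  (XJ : vfield (sub_space [set a | J a = nu])) (XJ_smooth : smooth_vfield XJ)
  (XJ_restr :
     related (val : sub_space [set a | J a = nu] -> Tstar Q) XJ XF)
  (X_nu : vfield Tnu) (X_nu_smooth : smooth_vfield X_nu)
  (X_nu_def : related pi_nu XJ X_nu)
  (* the vector field R_h, and R_h^nu *)
  (Rh : vfield (Vstar Pi)) (Rh_smooth : smooth_vfield Rh)
  (Rh_ker : forall (b : Vstar Pi) (v : Tan b), Omega_h h b (Rh b) v = 0)
  (Rh_eta : forall b : Vstar Pi, pull1 (tau Pi) (eta_form Pi) b (Rh b) = 1)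
  (RJ : vfield (sub_space [set b | JV b = nu])) (RJ_smooth : smooth_vfield RJ)
  (RJ_restr :
     related (val : sub_space [set b | JV b = nu] -> Vstar Pi) RJ Rh)
  (Rh_nu : vfield Vnu) (Rh_nu_smooth : smooth_vfield Rh_nu)
  (Rh_nu_def : related piV_nu RJ Rh_nu) :
  pull2 mu_nu Omega_nu = omega_nu /\
  (forall a : sub_space [set a | J a = nu],
     tmap mu_nu (X_nu (pi_nu a)) = Rh_nu (mu_nu (pi_nu a))).
Proof.
have [locQ _ _] := Qman; have [sPi _ _] := Pifib.
have [sh muh] := h_sec; have [spi pi_surj pi_lift] := pi_nu_sub.
have [spiV _ _] := piV_nu_sub; have [smu_nu _ _ _] := mu_nu_bundle.
have smu : smooth (mu Pi) by exact: smooth_mu.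
have tauRh b : Rh b ((Pi : Q -> R) \o tau Pi) = 1.
  rewrite -(Rh_eta b) /pull1 linearizeE => [|c u v].
    by rewrite etaE// /tmap dmapE//; [exact: smooth_tau|exact: sm_Pi].
  rewrite /tmap dmap_linear//; last exact: smooth_tau.
  exact: ldual_linear.
(* The projection to Q of R_h at the zero element of the fibre over q satisfies eta = 1. *)
have eta1 q : exists v : Tan q, v (Pi : Q -> R) = 1.
  pose b := mu Pi (@Covector R Q q 0).
  exists (tmap (tau Pi) (Rh b)); rewrite /tmap -(tauRh b) dmapE//.
    exact: smooth_tau.
  exact: sm_Pi.
have JVmu (a : sub_space [set a | J a = nu]) : [set b | JV b = nu] (mu Pi (val a)).
  have Ja : J (val a) = nu := set_valP a.
  by apply: etrans Ja; exact: (esym (congr1 (@^~ (val a)) JV_def)).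
pose muJ (a : sub_space [set a | J a = nu]) : sub_space [set b | JV b = nu] :=
  exist _ (mu Pi (val a)) (mem_set (JVmu a)).
have smuJ : smooth muJ.
  have H := smooth_comp (@smooth_val _ _ [set a | J a = nu]) smu.
 exact: (smooth_sub (f := muJ) H).
have mupi a : mu_nu (pi_nu a) = piV_nu (muJ a) by exact: mu_nu_def.
(* The chain rule for mu_nu o pi_nu = piV_nu o muJ. Both composites agree only propositionally at a,
   hence the free target point c. *)
have Tmupi a (u : Tan a) c : c = mu_nu (pi_nu a) ->
    dmap mu_nu c (tmap pi_nu u) = dmap piV_nu c (dmap muJ (muJ a) u).
  move=> ->; rewrite /tmap (dmap_comp _ spi smu_nu)//.
  by rewrite (dmap_comp _ smuJ spiV)//; exact: eq_dmap.
have TmuJ a (u : Tan a) : tmap (val : sub_space [set b | JV b = nu] -> _)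
     (dmap muJ (muJ a) u) =
   dmap (mu Pi) (mu Pi (val a)) (tmap (val : sub_space [set a | J a = nu] -> _) u).
  rewrite /tmap (dmap_comp _ smuJ (@smooth_val _ _ _))//.
  by rewrite (dmap_comp _ (@smooth_val _ _ _) smu).
split.
  apply: functional_extensionality_dep => p; apply/funext => u; apply/funext => v.
  have [a pa] := pi_surj p; case: _ / pa in u v *.
  (* Every tangent vector of the quotient lifts to the level set, where both reduced forms are known
     through their pullbacks. *)
  have [u' <-] := pi_lift a u; have [v' <-] := pi_lift a v.
  have := congr1 (fun w : form2 _ => w a u' v') omega_nu_def.
  rewrite /pull2 => ->; rewrite /tmap !Tmupi//.
  have := congr1 (fun w : form2 _ => w (muJ a) (dmap muJ (muJ a) u')
    (dmap muJ (muJ a) v')) Omega_nu_def.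
  rewrite /pull2 /tmap mupi => ->.
  rewrite -!/(tmap _ _) !TmuJ -(omega_h_pullback locQ sPi sh muh Fh_ext eta1).
  rewrite /Omega_h /pull2 /tmap.
  by rewrite !(dmap_comp _ smu sh (erefl _) (erefl _)).
(* Both sides are images under T piV_nu of vectors of the level set in the dual vertical bundle.
   These are compared after the inclusion, where they become T mu (X_F) and R_h. *)
move=> a; rewrite -X_nu_def /tmap Tmupi// mupi -Rh_nu_def; congr dmap.
apply: tan_sub_inj; rewrite TmuJ RJ_restr XJ_restr.
apply: (Hamiltonian_Reeb locQ sPi sh muh Fh_ext eta1) => //.
by move=> v; rewrite XF_def dfunE.
Qed.
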